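(* There is a universal constant $C>0$ such that the following holds. Let $\alpha\ge1$, $\frac1\alpha+\frac1\beta=1$ (with $\frac1\beta=0$ if $\alpha=1$), $0<\sigma\le L$, and let $X=(X_1,\dots,X_{d_1})^\top\in\mathbb R^{d_1\times d_2}$ be a random matrix with i.i.d. mean-zero rows such that for every unit vector $u\in\mathbb S^{d_2-1}$ and all integers $k\ge2$, $$\mathbb E\left|(X_i^\top u)^2-\mathbb E(X_i^\top u)^2\right|^k\le k^{\frac k\alpha}\sigma^2L^{k-2}.$$ Let $\Sigma:=\mathbb EX_iX_i^\top$, $M_{\max}:=\sqrt{\lambda_{\max}(\Sigma)}$, $M_{\min}:=\sqrt{\lambda_{\min}(\Sigma)}$, and let $s_{\max}$ and $s_{\min}$ be the maximum and the smallest nonzero singular values of $X$. If $\alpha\ge2$, then for any $t>0$, with probability at least $1-\exp(-t)$, $$d_1M_{\min}^2-C\min\left\{L(d_2+t)^{\frac1\alpha}d_1^{\frac1\beta},\ \sigma(d_2+t)^{\frac12}d_1^{\frac12}+L(d_2+t)\right\}\le s_{\min}^2\le s_{\max}^2\le d_1M_{\max}^2+C\min\left\{L(d_2+t)^{\frac1\alpha}d_1^{\frac1\beta},\ \sigma(d_2+t)^{\frac12}d_1^{\frac12}+L(d_2+t)\right\}.$$ If $1\le\alpha\le2$, then for any $t>0$, with probability at least $1-\exp(-t)$, $$d_1M_{\min}^2-C\sigma(d_2+t)^{\frac12}d_1^{\frac12}-CL\min\left\{(d_2+t)^{\frac1\alpha}d_1^{\frac1\beta},\ d_2+t\right\}\le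 s_{\min}^2\le s_{\max}^2\le d_1M_{\max}^2+C\sigma(d_2+t)^{\frac12}d_1^{\frac12}+CL\min\left\{(d_2+t)^{\frac1\alpha}d_1^{\frac1\beta},\ d_2+t\right\}.$$
   Context: $\mathbb S^{d-1}$ is the unit Euclidean sphere in $\mathbb R^d$; $\lambda_{\max},\lambda_{\min}$ denote the largest and smallest eigenvalues. The rows $X_i\in\mathbb R^{d_2}$ are independent of each other, but the components of a row may be dependent. *)

(* Defs.v *)
From mathcomp Require Import all_boot all_order all_algebra.
From mathcomp Require Import all_classical all_reals all_analysis.
Import Order.TTheory GRing.Theory Num.Theory.

Set Implicit Arguments.
Unset Strict Implicit.
Unset Printing Implicit Defensive.

Local Open Scope classical_set_scope.
Local Open Scope ring_scope.

Section Spectrum.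
Context {R : realType}.

Definition l2norm {n} (u : 'cV[R]_n) : R := Num.sqrt (\sum_j u j 0 ^+ 2).

Definition sphere (n : nat) : set 'cV[R]_n := [set u | l2norm u = 1].

(* Meant for symmetric matrices of positive size: the set of real eigenvalues
   is then finite and nonempty, so sup and inf are its maximum and minimum. *)
Definition lambda_max {n} (A : 'M[R]_n) : R := sup [set a | eigenvalue A a].
Definition lambda_min {n} (A : 'M[R]_n) : R := inf [set a | eigenvalue A a].

(* Square roots of the eigenvalues of A^T A. When n > m this set always
   contains 0, even if 0 is not among the min(m, n) singular values of A; this
   affects neither the largest nor the smallest nonzero one. *)
Definition singular_values {m n} (A : 'M[R]_(m, n)) : set R :=
  [set s | 0 <= s /\ eigenvalue (A^T *m A) (s ^+ 2)].

Definition s_max {m n} (A : 'M[R]_(m, n)) : R := sup (singular_values A).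

(* The smallest nonzero singular value. The zero matrix has none; since
   inf set0 = 0, the value is then 0. *)
Definition s_min {m n} (A : 'M[R]_(m, n)) : R :=
  inf [set s | singular_values A s /\ s != 0].

End Spectrum.

Section RandomElements.
Context {d d' : measure_display} {T : measurableType d} {U : measurableType d'}.
Context {R : realType} (P : probability T R).

Definition mutually_independent {I : finType} (Y : I -> T -> U) : Prop :=
  forall (J : {set I}) (B : I -> set U), (forall i, measurable (B i)) ->
    P (\bigcap_(i in [set` J]) (Y i @^-1` B i)) =
    (\prod_(i in J) P (Y i @^-1` B i))%E.

Definition identically_distributed {I : finType} (Y : I -> T -> U) : Prop :=
  forall (i j : I) (B : set U), measurable B ->
    P (Y i @^-1` B) = P (Y j @^-1` B).

End RandomElements.

Section RandomMatrix.
Context {d : measure_display} {T : measurableType d} {R : realType}.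
Context (P : probability T R) {d1 d2 : nat} (X : T -> 'M[R]_(d1, d2)).

Definition random_matrix : Prop :=
  forall i j, measurable_fun [set: T] (fun w => X w i j).

(* Tuples carry the product (Borel) sigma-algebra, matrices carry none. *)
Definition row_tuple (i : 'I_d1) (w : T) : d2.-tuple R :=
  [tuple X w i j | j < d2].

Definition iid_rows : Prop :=
  mutually_independent P row_tuple /\ identically_distributed P row_tuple.

Definition mean_zero_rows : Prop :=
  forall i j, ('E_P[fun w => X w i j] = 0)%E.

Definition row_form (i : 'I_d1) (u : 'cV[R]_d2) (w : T) : R :=
  (row i (X w) *m u) 0 0.

Definition second_moment (i : 'I_d1) : 'M[R]_d2 :=
  \matrix_(j, k) fine 'E_P[fun w => X w i j * X w i k].

End RandomMatrix.

(* Main.v *)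
Require Import Defs.
From HB Require Import structures.
From mathcomp Require Import all_boot all_order all_algebra.
From mathcomp Require Import all_classical all_reals all_analysis.
From mathcomp Require Import measurable_realfun.
From mathcomp Require Import ring lra.
Import Order.TTheory GRing.Theory Num.Theory.
Import numFieldNormedType.Exports.
Local Open Scope classical_set_scope.
Local Open Scope ring_scope.

Set Implicit Arguments.
Unset Strict Implicit.
Unset Printing Implicit Defensive.

(** For a unit vector [u], [sqnorm (X w *m u)] is the sum over the rows of the
    independent variables [row_form X i u ^+ 2], each of mean [qform Sigma u].
    With [D = X^T X - d1 Sigma], every squared singular value of [X] lies
    between [d1 * lambda_min Sigma - S] and [d1 * lambda_max Sigma + S], where
    [S] is the supremum of [`|qform D u|] over the sphere; the spectral facts
    needed here are [symmetric_max_eigenvalue] and [singular_values_between].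
    So everything reduces to a bound on [S] that holds outside an event of
    probability at most [expR (- t)].

    The supremum is reduced to a maximum over a finite set of unit vectors by
    [sphere_net]: [2 ^ (6 * d2)] points suffice to control [S] up to a factor 3.
    Hence it is enough that, with [s = d2 + t], each sum [qform D u] exceeds a
    level [x] in absolute value with probability at most [2 * expR (- 7 * s)]:
    a union bound costs a factor [2 ^ (6 * d2)], which [expR (- 7 * s)] absorbs.

    For one vector the level comes from Chernoff's method.  The moment
    assumption bounds the exponential moments through the Taylor series of the
    exponential ([expectation_expR_le]), and independence turns the exponential
    moment of the sum into a product ([integral_prod_independent]).  Two choices
    of the exponent give two levels:
    - [bernstein_tail]: for every [s], a multiple of
      [sigma * sqrt (d1 * s) + L * s];
    - [large_deviation_tail]: for [s >= d1], a multiple of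
      [L * d1 * (s / d1) `^ (1 / alpha)].

    These two levels give both minima of the theorem.  Put [w = s / d1]; since
    [1/beta = 1 - 1/alpha], the three expressions that are compared are
    [d1 * w `^ (1/2)], [d1 * w] and [d1 * w `^ (1/alpha)].  If [w <= 1], then
    [w <= w `^ (1/alpha)], and [w `^ (1/2) <= w `^ (1/alpha)] when [alpha >= 2],
    so Bernstein's level is within a factor 2 of either error term.  If
    [w >= 1], then [w `^ (1/alpha) <= w], and the second level is the smaller.

    A probability measure is monotone only on measurable sets, so the event of
    the theorem has to be measurable, although [s_min] is not continuous in the
    matrix.  It is expressed through the absence or presence of roots of the
    characteristic polynomial of [X^T X] in open intervals
    ([measurable_singular_values_between]). *)

(** * Quadratic forms and the extreme eigenvalues of a symmetric matrix *)

Section QuadraticForms.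
Context {R : realType}.
Implicit Types n : nat.

Definition sqnorm n (u : 'cV[R]_n) : R := \sum_j u j 0 ^+ 2.

Definition bform n (A : 'M[R]_n) (u v : 'cV[R]_n) : R := (u^T *m A *m v) 0 0.

Definition qform n (A : 'M[R]_n) (u : 'cV[R]_n) : R := bform A u u.

Lemma sqnorm_mul n (u : 'cV[R]_n) : sqnorm u = (u^T *m u) 0 0.
Proof. by rewrite mxE; apply: eq_bigr => j _; rewrite mxE expr2. Qed.

Lemma sqnorm_ge0 n (u : 'cV[R]_n) : 0 <= sqnorm u.
Proof. by apply: sumr_ge0 => j _; exact: sqr_ge0. Qed.

Lemma sqnorm_eq0 n (u : 'cV[R]_n) : (sqnorm u == 0) = (u == 0).
Proof.
rewrite psumr_eq0; last by move=> j _; exact: sqr_ge0.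
apply/allP/eqP => [u0|-> j _]; last by rewrite mxE expr0n/=.
apply/matrixP => j k; rewrite ord1 mxE; apply/eqP.
by rewrite -(sqrf_eq0 (u j 0)); apply: u0; rewrite mem_index_enum.
Qed.

Lemma sqnormZ n a (u : 'cV[R]_n) : sqnorm (a *: u) = a ^+ 2 * sqnorm u.
Proof. by rewrite mulr_sumr; apply: eq_bigr => j _; rewrite mxE exprMn. Qed.

Lemma sphereE n (u : 'cV[R]_n) : sphere u <-> sqnorm u = 1.
Proof.
rewrite /sphere /l2norm /=; split => [h|]; last first.
  by rewrite /sqnorm => ->; exact: sqrtr1.
by rewrite -[LHS]sqr_sqrtr ?sqnorm_ge0// h expr1n.
Qed.

Lemma bformDl n (A : 'M[R]_n) u v w : bform A (u + v) w = bform A u w + bform A v w.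
Proof. by rewrite /bform linearD/= !mulmxDl mxE. Qed.

Lemma bformDr n (A : 'M[R]_n) u v w : bform A u (v + w) = bform A u v + bform A u w.
Proof. by rewrite /bform mulmxDr mxE. Qed.

Lemma bformZl n (A : 'M[R]_n) a u v : bform A (a *: u) v = a * bform A u v.
Proof. by rewrite /bform linearZ/= -!scalemxAl mxE. Qed.

Lemma bformZr n (A : 'M[R]_n) a u v : bform A u (a *: v) = a * bform A u v.
Proof. by rewrite /bform -!scalemxAr mxE. Qed.

Lemma bformC n (A : 'M[R]_n) u v : A^T = A -> bform A u v = bform A v u.
Proof.
move=> As; rewrite /bform.
have -> : (v^T *m A *m u) 0 0 = (v^T *m A *m u)^T 0 0 by rewrite [RHS]mxE.
by rewrite !trmx_mul trmxK As mulmxA.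
Qed.

Lemma qformZ n (A : 'M[R]_n) a u : qform A (a *: u) = a ^+ 2 * qform A u.
Proof. by rewrite /qform bformZl bformZr mulrA expr2. Qed.

Lemma qform_gram m n (C : 'M[R]_(m, n)) u : qform (C^T *m C) u = sqnorm (C *m u).
Proof. by rewrite sqnorm_mul /qform /bform trmx_mul !mulmxA. Qed.

Lemma qformD n (A : 'M[R]_n) u v : A^T = A ->
  qform A (u + v) = qform A u + 2 * bform A u v + qform A v.
Proof.
by move=> As; rewrite /qform bformDl !bformDr (bformC v u As); ring.
Qed.

Lemma qform_sum n (A : 'M[R]_n) u : qform A u = \sum_i \sum_j u i 0 * A i j * u j 0.
Proof.
rewrite /qform /bform mxE exchange_big; apply: eq_bigr => j _.
by rewrite mxE big_distrl; apply: eq_bigr => i _ /=; rewrite mxE.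
Qed.

Lemma qform_bounded n (A : 'M[R]_n) :
  exists2 M : R, 0 < M & forall u, `|qform A u| <= M * sqnorm u.
Proof.
exists (1 + \sum_i \sum_j `|A i j|).
  by apply: ltr_wpDr => //; apply: sumr_ge0 => i _; exact: sumr_ge0.
move=> u; rewrite qform_sum mulrDl; apply: ler_wpDl.
  by rewrite mul1r sqnorm_ge0.
apply: le_trans (ler_norm_sum _ _ _) _; rewrite mulr_suml; apply: ler_sum => i _.
apply: le_trans (ler_norm_sum _ _ _) _; rewrite mulr_suml; apply: ler_sum => j _.
rewrite mulrAC normrM mulrC ler_wpM2l// normrM.
have le k : u k 0 ^+ 2 <= sqnorm u.
  by rewrite /sqnorm (bigD1 k)//= lerDl; apply: sumr_ge0 => l _; exact: sqr_ge0.
have := le i; have := le j; rewrite -(real_normK (num_real (u i 0))).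
rewrite -(real_normK (num_real (u j 0))).
have := sqr_ge0 (`|u i 0| - `|u j 0|); nra.
Qed.

Lemma qform_homogeneous_le n (A : 'M[R]_n) M :
  (forall u, sqnorm u = 1 -> `|qform A u| <= M) ->
  forall u, `|qform A u| <= M * sqnorm u.
Proof.
move=> h u; have [->|u0] := eqVneq u 0.
  by rewrite -(scale0r 0) qformZ sqnormZ expr0n/= !mul0r normr0 mulr0.
have n0 : 0 < sqnorm u by rewrite lt_def sqnorm_eq0 u0 sqnorm_ge0.
have s0 : Num.sqrt (sqnorm u) != 0 by rewrite sqrtr_eq0 -ltNge.
have := h ((Num.sqrt (sqnorm u))^-1 *: u).
rewrite sqnormZ qformZ exprVn sqr_sqrtr ?sqnorm_ge0// mulVf ?gt_eqF// => /(_ erefl).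
by rewrite normrM ger0_norm ?invr_ge0 ?sqnorm_ge0 // mulrC ler_pdivrMr.
Qed.

(** The supremum [a] of the quadratic form over the unit sphere is an
    eigenvalue: otherwise the positive semidefinite form of [B = a - A] is
    invertible, hence bounded below on the sphere, and [a] can be lowered. *)
Lemma symmetric_max_eigenvalue n (A : 'M[R]_n) : (0 < n)%N -> A^T = A ->
  exists2 a : R, eigenvalue A a & forall u, qform A u <= a * sqnorm u.
Proof.
move=> n0 As; pose S := [set qform A u | u in [set u | sqnorm u = 1]].
have [M M0 HM] := qform_bounded A.
have S0 : S !=set0.
  pose u : 'cV[R]_n := \col_j (j == Ordinal n0)%:R.
  exists (qform A u), u => //=; rewrite /sqnorm (bigD1 (Ordinal n0))//= mxE eqxx expr1n.
  by rewrite big1 ?addr0// => j /negbTE jn; rewrite mxE jn expr0n.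
have ubS : has_ubound S.
  exists M => _ [u /= u1 <-]; apply: le_trans (ler_norm _) _.
  by rewrite -[M]mulr1 -u1.
pose a := sup S.
have qa u : qform A u <= a * sqnorm u.
  have [->|u0] := eqVneq u 0.
    by rewrite -(scale0r 0) qformZ sqnormZ expr0n/= !mul0r mulr0.
  have q0 : 0 < sqnorm u by rewrite lt_def sqnorm_eq0 u0 sqnorm_ge0.
  have : S (qform A ((Num.sqrt (sqnorm u))^-1 *: u)).
    by exists ((Num.sqrt (sqnorm u))^-1 *: u) => //=; rewrite sqnormZ exprVn
      sqr_sqrtr ?sqnorm_ge0// mulVf ?gt_eqF.
  move=> /(ub_le_sup ubS); rewrite qformZ exprVn sqr_sqrtr ?sqnorm_ge0//.
  by rewrite mulrC ler_pdivrMr.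
exists a => //; rewrite /eigenvalue /eigenspace kermx_eq0 row_free_unit; apply/negP => Bu.
set B := A - a%:M in Bu.
have Bs : B^T = B by rewrite /B linearB/= As tr_scalar_mx.
have BE u : qform B u = qform A u - a * sqnorm u.
  rewrite /qform /bform /B mulmxBr mulmxBl mxE [X in _ + X]mxE; congr (_ - _).
  by rewrite mul_mx_scalar -scalemxAl mxE sqnorm_mul.
have [N N0 HN] := qform_bounded B.
have [K K0 HK] := qform_bounded ((invmx B)^T *m invmx B).
suff : sup S <= a - (N * K)^-1.
  rewrite lerBrDr -/a gerDl leNgt invr_gt0.
  by rewrite mulr_gt0.
apply: ge_sup => // _ [u /= u1 <-].
have B0 v : qform B v <= 0 by rewrite BE subr_le0 qa.
pose v := B *m u.
have : sqnorm u <= K * sqnorm v.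
  apply: le_trans (HK v); apply: le_trans (ler_norm _).
  by rewrite qform_gram mulKmx.
have := B0 (u + N^-1 *: v).
rewrite qformD// bformZr qformZ.
(* A gradient step: [bform B u v] is [sqnorm (B *m u)], which dominates the
   quadratic term when the step is [1 / N]. *)
have -> : bform B u v = sqnorm v by rewrite /bform -{1}Bs -trmx_mul sqnorm_mul.
have /ler_normlP[] := HN v.
rewrite (BE u) u1 invfM exprVn => h1 _ h2 h3.
have h4 : N^-1 * K^-1 <= N^-1 * sqnorm v.
  by rewrite ler_pM2l ?invr_gt0// -[K^-1]mulr1 ler_pdivrMl.
have h5 : N ^- 2 * (- qform B v) <= N^-1 * sqnorm v.
  rewrite expr2 invfM -mulrA ler_pM2l ?invr_gt0// ler_pdivrMl//.
lra.
Qed.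

End QuadraticForms.

(** * Singular values of a rectangular matrix *)

Section SingularValues.
Context {R : realType}.
Implicit Types m n : nat.

(** [eigenvalue] is about row vectors and the forms act on columns: the witness
    is the transpose of a normalized left eigenvector. *)
Lemma eigenvalue_qform n (A : 'M[R]_n) a : eigenvalue A a ->
  exists2 u : 'cV[R]_n, sqnorm u = 1 & qform A u = a.
Proof.
move=> /eigenvalueP[v vA v0].
have q0 : 0 < sqnorm v^T.
  by rewrite lt_def sqnorm_ge0 sqnorm_eq0 trmx_eq0 v0.
have sq : (Num.sqrt (sqnorm v^T))^-1 ^+ 2 * sqnorm v^T = 1.
  by rewrite exprVn sqr_sqrtr ?sqnorm_ge0// mulVf ?gt_eqF.
exists ((Num.sqrt (sqnorm v^T))^-1 *: v^T); first by rewrite sqnormZ.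
have -> : a = a * 1 by rewrite mulr1.
rewrite qformZ -sq mulrCA; congr (_ * _).
by rewrite /qform /bform trmxK vA -scalemxAl mxE sqnorm_mul trmxK.
Qed.

Lemma eigenvalue_bounded n (A : 'M[R]_n) :
  exists2 M : R, 0 < M & forall a, eigenvalue A a -> `|a| <= M.
Proof.
have [M M0 HM] := qform_bounded A; exists M => // a /eigenvalue_qform[u u1 <-].
by rewrite -[M]mulr1 -u1.
Qed.

Lemma qform_le_lambda_max n (A : 'M[R]_n) u : (0 < n)%N -> A^T = A ->
  qform A u <= lambda_max A * sqnorm u.
Proof.
move=> n0 As; have [a ea qa] := symmetric_max_eigenvalue n0 As.
apply: le_trans (qa u) _; apply: ler_wpM2r; first exact: sqnorm_ge0.
apply: ub_le_sup => //; have [M _ HM] := eigenvalue_bounded A.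
by exists M => b /= /HM; exact/le_trans/ler_norm.
Qed.

Lemma eigenvalueN n (A : 'M[R]_n) a : eigenvalue (- A) (- a) = eigenvalue A a.
Proof.
by apply/eigenvalueP/eigenvalueP => -[v vA v0]; exists v => //;
  move: vA; rewrite mulmxN scaleNr; [move/oppr_inj | move=> ->].
Qed.

Lemma lambda_min_le_qform n (A : 'M[R]_n) u : (0 < n)%N -> A^T = A ->
  lambda_min A * sqnorm u <= qform A u.
Proof.
move=> n0 As; have AsN : (- A)^T = - A by rewrite linearN/= As.
have [a ea qa] := symmetric_max_eigenvalue n0 AsN.
have qN : qform (- A) u = - qform A u.
  by rewrite /qform /bform mulmxN mulNmx mxE.
have := qa u; rewrite qN lerNl -mulNr; apply: le_trans.
apply: ler_wpM2r; first exact: sqnorm_ge0.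
apply: ge_inf; last by rewrite /= -eigenvalueN opprK.
have [M _ HM] := eigenvalue_bounded A.
by exists (- M) => b /= /HM; rewrite ler_norml => /andP[].
Qed.

Lemma gram_sym m n (X : 'M[R]_(m, n)) : (X^T *m X)^T = X^T *m X.
Proof. by rewrite trmx_mul trmxK. Qed.

Lemma gram_eigenvalue_ge0 m n (X : 'M[R]_(m, n)) a :
  eigenvalue (X^T *m X) a -> 0 <= a.
Proof. by move=> /eigenvalue_qform[u _ <-]; rewrite qform_gram sqnorm_ge0. Qed.

Lemma singular_values_bounded m n (X : 'M[R]_(m, n)) : has_ubound (singular_values X).
Proof.
have [M M0 HM] := eigenvalue_bounded (X^T *m X).
exists (1 + M) => s [s0] /HM; rewrite ger0_norm ?sqr_ge0//.
by nra.
Qed.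

Lemma singular_values_sqrt m n (X : 'M[R]_(m, n)) a :
  eigenvalue (X^T *m X) a -> singular_values X (Num.sqrt a).
Proof.
by move=> ea; split; rewrite ?sqrtr_ge0// sqr_sqrtr// (gram_eigenvalue_ge0 ea).
Qed.

Lemma s_max_ge0 m n (X : 'M[R]_(m, n)) : 0 <= s_max X.
Proof.
have [/eqP|/set0P[s Xs]] := boolP (singular_values X == set0).
  by rewrite /s_max => ->; rewrite sup0.
have [s0 _] := Xs; apply: le_trans s0 _.
exact: ub_le_sup (singular_values_bounded X) _ Xs.
Qed.

Lemma s_min_ge0 m n (X : 'M[R]_(m, n)) : 0 <= s_min X.
Proof.
rewrite /s_min; set S := [set _ | _].
have [/eqP->|/set0P S0] := boolP (S == set0); first by rewrite inf0.
by apply: lb_le_inf => // s [[]].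
Qed.

Lemma s_min_le_s_max m n (X : 'M[R]_(m, n)) : s_min X <= s_max X.
Proof.
rewrite /s_min; set S := [set _ | _].
have [/eqP->|/set0P[s Ss]] := boolP (S == set0); first by rewrite inf0 s_max_ge0.
have [Xs _] := Ss; apply: (@le_trans _ _ s).
  by apply: ge_inf => //; exists 0 => t [[]].
exact: ub_le_sup (singular_values_bounded X) _ Xs.
Qed.

(** Both this lemma and the next one describe the bound by the location of the
    eigenvalues of the Gram matrix; the deviation estimate and the
    measurability of the event are both derived from this description. *)
Lemma s_max_sqr_leP m n (X : 'M[R]_(m, n)) b : 0 <= b ->
  s_max X ^+ 2 <= b <-> (forall a, b < a -> ~ eigenvalue (X^T *m X) a).
Proof.
move=> b0; split => [sb a ba ea|h].
  have := ub_le_sup (singular_values_bounded X) (singular_values_sqrt ea).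
  rewrite -/(s_max X) -(ler_pXn2r (n := 2))// ?nnegrE ?sqrtr_ge0 ?s_max_ge0//.
  rewrite sqr_sqrtr ?(gram_eigenvalue_ge0 ea)// => /le_trans/(_ sb).
  by rewrite leNgt ba.
suff sb : s_max X <= Num.sqrt b.
  by rewrite -(sqr_sqrtr b0) ler_pXn2r// ?nnegrE ?sqrtr_ge0 ?s_max_ge0.
have [/eqP|/set0P S0] := boolP (singular_values X == set0).
  by rewrite /s_max => ->; rewrite sup0 sqrtr_ge0.
apply: ge_sup => // s [s0 es]; rewrite leNgt; apply/negP => bs.
apply: h es; rewrite -(sqr_sqrtr b0).
by rewrite ltr_pXn2r// ?nnegrE ?sqrtr_ge0.
Qed.

(** A matrix without nonzero singular values has [s_min X = 0], as the infimum
    of the empty set; the existence of a positive eigenvalue excludes it. *)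
Lemma s_min_sqr_geP m n (X : 'M[R]_(m, n)) a : 0 < a ->
  a <= s_min X ^+ 2 <->
  (exists2 b, 0 < b & eigenvalue (X^T *m X) b) /\
  (forall b, 0 < b -> b < a -> ~ eigenvalue (X^T *m X) b).
Proof.
move=> a0; rewrite /s_min; set S := [set _ | _]; split => [sa|[[b b0 eb] h]].
  have [S0|/set0P S0] := eqVneq S set0.
    by move: sa; rewrite S0 inf0 expr0n/= leNgt a0.
  split.
    have [s [[s0 es] sn0]] := S0; exists (s ^+ 2) => //.
    by rewrite exprn_even_gt0.
  move=> b b0 ba eb.
  have : S (Num.sqrt b).
    by split; [exact: singular_values_sqrt|rewrite sqrtr_eq0 -ltNge].
  have lS : has_lbound S by exists 0 => t [[]].
  move=> /(ge_inf lS); rewrite -(ler_pXn2r (n := 2))// ?nnegrE ?sqrtr_ge0//.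
    by rewrite (sqr_sqrtr (ltW b0)) => /(le_trans sa); rewrite leNgt ba.
  by apply: lb_le_inf => // s [[]].
have S0 : S !=set0.
  by exists (Num.sqrt b); split; [exact: singular_values_sqrt|rewrite sqrtr_eq0 -ltNge].
rewrite -(sqr_sqrtr (ltW a0)) ler_pXn2r// ?nnegrE ?sqrtr_ge0//; last first.
  by apply: lb_le_inf => // s [[]].
apply: lb_le_inf => // s [[s0 es] sn0]; rewrite leNgt; apply/negP => bs.
apply: h es; first by rewrite exprn_even_gt0.
rewrite -(sqr_sqrtr (ltW a0)).
by rewrite ltr_pXn2r// ?nnegrE ?sqrtr_ge0.
Qed.

(** Every eigenvalue of [X^T X] is a value of its quadratic form on the sphere,
    so it lies in [`[a, b]].  If [X^T X] is singular, this forces [a <= 0] and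
    the lower bound is trivial; if [a > 0], all eigenvalues are positive, and
    one exists, so that [s_min] is an infimum over a nonempty set. *)
Lemma singular_values_between m n (X : 'M[R]_(m, n)) a b : (0 < n)%N ->
  (forall u : 'cV[R]_n, sqnorm u = 1 -> a <= sqnorm (X *m u) <= b) ->
  a <= s_min X ^+ 2 /\ s_min X ^+ 2 <= s_max X ^+ 2 /\ s_max X ^+ 2 <= b.
Proof.
move=> n0 h; have [c ec _] := symmetric_max_eigenvalue n0 (gram_sym X).
have hE d : eigenvalue (X^T *m X) d -> a <= d <= b.
  by move=> /eigenvalue_qform[u /h]; rewrite qform_gram => + <-.
split; last split.
- have [a0|a0] := leP a 0; first exact: le_trans a0 (sqr_ge0 _).
  apply/s_min_sqr_geP => //; split; last first.
    by move=> d _ da /hE/andP[]; rewrite leNgt da.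
  by exists c => //; case/andP: (hE _ ec) => /(lt_le_trans a0).
- by rewrite ler_pXn2r// ?nnegrE ?s_min_ge0 ?s_max_ge0 ?s_min_le_s_max.
- apply/s_max_sqr_leP.
    by case/andP: (hE _ ec) => _; apply: le_trans; exact: gram_eigenvalue_ge0 ec.
  by move=> d bd /hE/andP[_]; rewrite leNgt bd.
Qed.

End SingularValues.

(** * Measurability of events on the singular values *)

Section Measurability.
Context {R : realType} {d : measure_display} {T : measurableType d}.

(** A polynomial has a root in the open interval iff, on some closed rational
    subinterval, its values at rational points come arbitrarily close to [0];
    compactness of the subinterval gives the converse. *)
Lemma measurable_exists_root (p : T -> {poly R}) (a b : R) :
  (forall x, measurable_fun setT (fun w => (p w).[x])) ->
  measurable [set w | exists x, a < x < b /\ root (p w) x].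
Proof.
move=> mp.
pose ok (q : rat * rat) := a < ratr q.1 /\ ratr q.2 < b.
have -> : [set w | exists x, a < x < b /\ root (p w) x] =
  \bigcup_(q in [set q | ok q]) \bigcap_(n in [set: nat])
    \bigcup_(r in [set r : rat | ((ratr q.1 : R) <= ratr r) && ((ratr r : R) <= ratr q.2)])
      [set w | `|(p w).[ratr r]| < (n.+1%:R^-1 : R)].
  apply/seteqP; split => w /=.
    move=> [x [/andP[ax xb] px]].
    have [q1 /itvP h1] := rat_in_itvoo ax; have [q2 /itvP h2] := rat_in_itvoo xb.
    exists (q1, q2) => /=; first by rewrite /ok /= !(h1, h2).
    move=> n _ /=.
    have cp := @continuous_horner _ (p w) x.
    have n0 : 0 < n.+1%:R^-1 :> R by rewrite invr_gt0.
    have /cvgrPdist_lt/(_ _ n0) := cp.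
    move=> /nbhs_ballP[e /= e0 he].
    have xm : x < Num.min (x + e) (ratr q2) by rewrite lt_min ltrDl e0 !(h1, h2).
    have [r] := rat_in_itvoo xm; rewrite in_itv/= lt_min => /and3P[xr re r2].
    exists r => /=.
      by rewrite (ltW r2) andbT (le_trans _ (ltW xr))// ltW// h1.
    have := he (ratr r); rewrite /ball/= distrC ger0_norm ?subr_ge0 ?ltW//.
    rewrite ltrBlDl re => /(_ isT); rewrite distrC.
    by move/eqP: px => ->; rewrite subr0.
  move=> [[q1 q2] [/= aq qb] h].
  have [r0 /= /andP[q1r r2q] _] := h 0%N I.
  have q12 : (ratr q1 : R) <= ratr q2 := le_trans q1r r2q.
  have cf : {within `[ratr q1, ratr q2], continuous (fun x => `|(p w).[x]|)}.
    apply: continuous_subspaceT => x; apply: continuous_comp.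
      exact: continuous_horner.
    exact: norm_continuous.
  (* The values of [`|p w|] on the closed interval come close to [0], so the
     minimum, which is attained, is [0]. *)
  have [x xin xmin] := EVT_min q12 cf.
  move: (xin); rewrite in_itv/= => /andP[x1 x2].
  exists x; split; first by rewrite (lt_le_trans aq x1) (le_lt_trans x2 qb).
  rewrite rootE -normr_eq0 eq_le normr_ge0 andbT leNgt; apply/negP => p0.
  have [n _ hn] : \forall n \near \oo, n.+1%:R^-1 < `|(p w).[x]|.
    exact: (near_infty_natSinv_lt (PosNum p0)).
  have [r /= rin hr] := h n I.
  have := hn n (leqnn _); rewrite /= => /(lt_trans hr).
  by rewrite ltNge xmin// in_itv.
rewrite bigcup_mkcond; apply: countable_bigcupT_measurable => // q.
case: ifP => // _; apply: bigcapT_measurable => n.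
rewrite bigcup_mkcond; apply: countable_bigcupT_measurable => // r.
case: ifP => // _.
rewrite -[X in measurable X]setTI.
have -> : [set w | `|(p w).[ratr r]| < (n.+1%:R^-1 : R)] =
   (fun w => `|(p w).[ratr r]|) @^-1` `]-oo, n.+1%:R^-1[.
  by apply/seteqP; split => w /=; rewrite in_itv.
have mf : measurable_fun setT (fun w => `|(p w).[ratr r]|).
  exact: measurableT_comp (mp _).
exact: mf.
Qed.

Lemma char_poly_horner n (A : 'M[R]_n) x : (char_poly A).[x] = \det (x%:M - A).
Proof.
rewrite /char_poly -/(horner_eval x _) -det_map_mx; congr (\det _).
by apply/matrixP => i j; rewrite !mxE/= /horner_eval !(hornerMn, hornerE).
Qed.

Lemma measurable_det n (G : T -> 'M[R]_n) :
  (forall i j, measurable_fun setT (fun w => G w i j)) ->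
  measurable_fun setT (fun w => \det (G w)).
Proof.
move=> mG; apply: measurable_sum => s; apply: measurable_funM => //.
by apply: measurable_prod => i _; exact: mG.
Qed.

Section Gram.
Context (m n : nat) (X : T -> 'M[R]_(m, n)).
Hypothesis mX : forall i j, measurable_fun setT (fun w => X w i j).

Let G w := (X w)^T *m X w.

Lemma measurable_exists_eigenvalue a b :
  measurable [set w | exists x, a < x < b /\ eigenvalue (G w) x].
Proof.
have -> : [set w | exists x, a < x < b /\ eigenvalue (G w) x] =
    [set w | exists x, a < x < b /\ root (char_poly (G w)) x].
  by apply/seteqP; split => w /= [x [xab ex]]; exists x; split => //;
    move: ex; rewrite eigenvalue_root_char.
apply: measurable_exists_root => x.
under eq_fun do rewrite char_poly_horner.
apply: measurable_det => i j.
under eq_fun do rewrite mxE [X in _ + X]mxE.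
apply: measurable_funB; first by [].
under eq_fun do rewrite mxE; apply: measurable_sum => k.
under eq_fun do rewrite mxE.
by apply: measurable_funM.
Qed.

Lemma measurable_exists_eigenvalue_gt a :
  measurable [set w | exists x, a < x /\ eigenvalue (G w) x].
Proof.
have -> : [set w | exists x, a < x /\ eigenvalue (G w) x] =
   \bigcup_k [set w | exists x, a < x < k%:R /\ eigenvalue (G w) x].
  apply/seteqP; split => w /= [x].
    move=> [ax ex]; exists (Num.bound `|x|) => //=; exists x; split => //.
    by rewrite ax/= (le_lt_trans (ler_norm _))// archi_boundP.
  by move=> _ /= [y [/andP[ay _] ey]]; exists y.
by apply: bigcupT_measurable => k; exact: measurable_exists_eigenvalue.
Qed.

Lemma measurable_singular_values_between a b :
  measurable [set w | a <= s_min (X w) ^+ 2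
                 /\ s_min (X w) ^+ 2 <= s_max (X w) ^+ 2
                 /\ s_max (X w) ^+ 2 <= b].
Proof.
have -> : [set w | a <= s_min (X w) ^+ 2
                 /\ s_min (X w) ^+ 2 <= s_max (X w) ^+ 2
                 /\ s_max (X w) ^+ 2 <= b] =
   [set w | a <= s_min (X w) ^+ 2] `&` [set w | s_max (X w) ^+ 2 <= b].
  apply/seteqP; split => w /=; first by move=> [? []].
  move=> [? ?]; split => //; split => //.
  by rewrite ler_pXn2r// ?nnegrE ?s_min_ge0 ?s_max_ge0 ?s_min_le_s_max.
apply: measurableI.
  have [a0|a0] := leP a 0.
    rewrite (_ : [set _ | _] = setT)//; apply/seteqP; split => w //= _.
    exact: le_trans a0 (sqr_ge0 _).
  rewrite (_ : [set _ | _] = [set w | exists x, 0 < x /\ eigenvalue (G w) x] `\`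
     [set w | exists x, 0 < x < a /\ eigenvalue (G w) x]).
    by apply: measurableD; [exact: measurable_exists_eigenvalue_gt
      | exact: measurable_exists_eigenvalue].
  apply/seteqP; split => w /=.
    move/(s_min_sqr_geP _ a0) => [[x x0 ex] h]; split; first by exists x.
    by move=> [y [/andP[y0 ya] /h]]; apply.
  move=> [[x [x0 ex]] h]; apply/(s_min_sqr_geP _ a0); split; first by exists x.
  by move=> y y0 ya ey; apply: h; exists y; rewrite y0 ya.
have [b0|b0] := leP 0 b; last first.
  rewrite (_ : [set _ | _] = set0)//; apply/seteqP; split => w //=.
  by rewrite leNgt (lt_le_trans b0 (sqr_ge0 _)).
rewrite (_ : [set _ | _] = ~` [set w | exists x, b < x /\ eigenvalue (G w) x]).
  by apply: measurableC; exact: measurable_exists_eigenvalue_gt.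
apply/seteqP; split => w /=.
  by move/(s_max_sqr_leP _ b0) => h [x [bx /h]]; apply.
by move=> h; apply/(s_max_sqr_leP _ b0) => x bx ex; apply: h; exists x.
Qed.

End Gram.

End Measurability.

(** * A net of the sphere with exponentially many points *)

Section Net.
Context {R : realType} (n : nat).

Let code : finType := (n.-tuple 'I_(4 * n).+1 * {ffun 'I_n -> bool})%type.

(** A code lists the absolute values and the signs of the coordinates of an
    integer vector.  Bounding the sum of the absolute values, instead of each of
    them by [4 * sqrt n], keeps the number of codes exponential in [n]. *)
Definition codes : {set code} :=
  finset.setX [set t : n.-tuple 'I_(4 * n).+1 | (\sum_(i <- t) i <= 4 * n)%N]%SET finset.setT.

Definition net_point (c : code) : 'cV[R]_n :=
  \col_j ((-1) ^+ c.2 j * (tnth c.1 j)%:R).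

(** There are ['C(5 * n, n)] choices of the absolute values and [2 ^ n] of the
    signs. *)
Lemma card_codes : (#|codes| <= 2 ^ (6 * n))%N.
Proof.
rewrite cardsX card_partial_ord_partitions cardsT card_ffun card_bool card_ord.
rewrite (_ : (6 * n = (n + 4 * n) + n)%N); last by rewrite -mulSn -mulSnr.
rewrite [leqRHS]expnD leq_mul2r; apply/orP; right.
have := Pascal 1 1 (n + 4 * n); rewrite addn1 => ->.
have h : (n < (n + 4 * n).+1)%N by rewrite ltnS leq_addr.
by rewrite (bigD1 (Ordinal h))//= !exp1n !muln1 leq_addr.
Qed.

(** Scaling the sphere by [4 * sqrt n] and truncating each coordinate towards
    zero moves a point by at most [sqrt n]. *)
Lemma net_rounding (u : 'cV[R]_n) : sqnorm u = 1 ->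
  exists2 c, c \in codes &
    sqnorm (net_point c) <= 16 * n%:R /\
    sqnorm ((4 * Num.sqrt n%:R) *: u - net_point c) <= n%:R.
Proof.
move=> u1; set r := 4 * Num.sqrt n%:R.
have r0 : 0 <= r by rewrite mulr_ge0 ?sqrtr_ge0.
have r2 : r ^+ 2 = 16 * n%:R by rewrite exprMn sqr_sqrtr// -natrX.
pose t j := Num.truncn (r * `|u j 0|).
have tj j : (t j)%:R <= r * `|u j 0| < (t j)%:R + 1.
  by rewrite natr1 truncn_itv// mulr_ge0.
have st : (\sum_j t j <= 4 * n)%N.
  rewrite -(ler_nat R) natr_sum; apply: (@le_trans _ _ (\sum_j 2 * (n%:R * u j 0 ^+ 2 + 1))).
    apply: ler_sum => j _; have /andP[h _] := tj j; apply: le_trans h _.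
    (* Young's inequality, with weights that make the bounds add up to
       [4 * n] over the coordinates. *)
    have := sqr_ge0 (r * `|u j 0| - 4).
    rewrite sqrrB exprMn r2 real_normK ?num_real// => h; lra.
  rewrite -mulr_sumr big_split/= -mulr_sumr -/(sqnorm u) u1 sumr_const card_ord natrM.
  by lra.
have tle j : (t j < (4 * n).+1)%N.
  by rewrite ltnS (leq_trans _ st)// (bigD1 j)//= leq_addr.
pose c : code := ([tuple Ordinal (tle j) | j < n], [ffun j => u j 0 < 0]).
have cE j : net_point c j 0 = (-1) ^+ (u j 0 < 0)%R * (t j)%:R.
  by rewrite mxE/= ffunE tnth_mktuple.
exists c.
  rewrite !inE/= andbT big_map big_enum/=.
  exact: st.
have uE j : u j 0 = (-1) ^+ (u j 0 < 0)%R * `|u j 0| by exact: numEsign.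
split.
  rewrite -r2 -[r ^+ 2]mulr1 -u1 -sqnormZ; apply: ler_sum => j _.
  rewrite cE [X in _ <= X ^+ 2]mxE exprMn sqrr_sign mul1r exprMn -(real_normK (num_real (u j 0))).
  rewrite -exprMn ler_pXn2r// ?nnegrE ?mulr_ge0//.
  by case/andP: (tj j).
apply: (@le_trans _ _ (\sum_(j < n) 1)); last by rewrite sumr_const card_ord.
apply: ler_sum => j _.
have -> : (r *: u - net_point c) j 0 = (-1) ^+ (u j 0 < 0)%R * (r * `|u j 0| - (t j)%:R).
  by rewrite mxE [X in _ + X]mxE cE mxE {1}(uE j); ring.
rewrite exprMn sqrr_sign mul1r -[leRHS](expr1n _ 2) ler_pXn2r ?nnegrE//.
- by case/andP: (tj j) => _; rewrite lerBlDl => /ltW.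
- by rewrite subr_ge0; case/andP: (tj j).
Qed.

(** Let [S] be the supremum of [`|qform D u|] over the sphere and write a vector
    [y] of norm [4 * sqrt n] as [z + e], with [z] an integer point, no longer
    than [y], and [sqnorm e <= sqnorm y / 16].  Then [qform D z] contributes at
    most [x * sqnorm y] to [qform D y], and the cross term and [qform D e] at
    most [9 / 16 * S * sqnorm y].  Hence [S <= x + 9 / 16 * S], so that
    [S <= 3 * x]. *)
Lemma sphere_net : exists s : seq 'cV[R]_n,
  [/\ (size s <= 2 ^ (6 * n))%N, forall u, u \in s -> sqnorm u = 1 &
   forall (D : 'M[R]_n) (x : R), D^T = D -> 0 <= x ->
     (forall u, u \in s -> `|qform D u| <= x) ->
     forall u, sqnorm u = 1 -> `|qform D u| <= 3 * x].
Proof.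
pose normalize (z : 'cV[R]_n) := (Num.sqrt (sqnorm z))^-1 *: z.
exists [seq normalize (net_point c) | c <- enum codes & net_point c != 0].
have normE z : z != 0 -> sqnorm (normalize z) = 1.
  move=> z0; rewrite sqnormZ exprVn sqr_sqrtr ?sqnorm_ge0// mulVf//.
  by rewrite sqnorm_eq0.
split.
- rewrite size_map size_filter; apply: leq_trans (count_size _ _) _.
  by rewrite -cardE card_codes.
- by move=> u /mapP[c]; rewrite mem_filter => /andP[c0 _] ->; exact: normE.
move=> D x Ds x0 hx.
have hz c : c \in codes -> `|qform D (net_point c)| <= x * sqnorm (net_point c).
  move=> cc; set z := net_point c; have [->|z0] := eqVneq z 0.
    by rewrite -(scale0r 0) qformZ sqnormZ expr0n/= !mul0r normr0 mulr0.
  have q0 : 0 < sqnorm z by rewrite lt_def sqnorm_eq0 z0 sqnorm_ge0.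
  have : `|qform D (normalize z)| <= x.
    by apply: hx; apply/mapP; exists c => //; rewrite mem_filter z0 mem_enum.
  rewrite qformZ exprVn sqr_sqrtr ?sqnorm_ge0//.
  by rewrite normrM ger0_norm ?invr_ge0 ?sqnorm_ge0// mulrC ler_pdivrMr.
have [M M0 HM] := qform_bounded D.
pose V := [set `|qform D u| | u in [set u | sqnorm u = 1]].
have ubV : has_ubound V.
  by exists M => _ [u /= u1 <-]; rewrite -[M]mulr1 -u1.
pose S := sup V.
have VS u : sqnorm u = 1 -> `|qform D u| <= S.
  by move=> u1; apply: ub_le_sup => //; exists u.
have HS := qform_homogeneous_le VS.
have step u : sqnorm u = 1 -> `|qform D u| <= x + 9 / 16 * S.
  move=> u1; have [c cc [zn en]] := net_rounding u1.
  set z := net_point c in zn en; set r := 4 * _ in en; set e := r *: u - z in en.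
  have r2 : r ^+ 2 = 16 * n%:R by rewrite exprMn sqr_sqrtr// -natrX.
  have n0 : 0 < n%:R :> R.
    rewrite ltr0n lt0n; apply/eqP => n0; move: u1.
    rewrite /sqnorm big1 => [/eqP|j _]; first by rewrite eq_sym oner_eq0.
    by have := ltn_ord j; rewrite {2}n0.
  have S0 : 0 <= S by apply: le_trans (VS _ u1).
  have hq : r ^+ 2 * qform D u = qform D z + 2 * bform D z e + qform D e.
    by rewrite -qformZ -qformD// /e addrC subrK.
  (* Polarization bounds the cross term by values of the form; scaling [e] by 4
     balances it against [z]. *)
  have hp : qform D (z + 4 *: e) - qform D (z + (-4) *: e) = 16 * bform D z e.
    rewrite !qformD// !bformZr !qformZ; ring.
  have hs : sqnorm (z + 4 *: e) + sqnorm (z + (-4) *: e) = 2 * sqnorm z + 32 * sqnorm e.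
    rewrite !mulr_sumr -!big_split/=; apply: eq_bigr => j _.
    rewrite !mxE; ring.
  have := HS (z + 4 *: e); have := HS (z + (-4) *: e); have := HS e.
  have := hz _ cc; rewrite -/z.
  rewrite !ler_norml => /andP[a1 a2] /andP[b1 b2] /andP[c1 c2] /andP[d1 d2].
  have f1 : S * sqnorm e <= S * n%:R by rewrite ler_wpM2l.
  have f2 : x * sqnorm z <= x * (16 * n%:R) by rewrite ler_wpM2l.
  have f3 : S * (2 * sqnorm z + 32 * sqnorm e) <= S * (64 * n%:R).
    by apply: ler_wpM2l => //; lra.
  rewrite -hs mulrDr in f3.
  rewrite r2 in hq.
  apply/andP; split; rewrite -(ler_pM2l n0); lra.
move=> u u1; apply: le_trans (VS _ u1) _.
have : S <= x + 9 / 16 * S.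
  by apply: ge_sup => [|_ [v /= v1 <-]]; [exists `|qform D u|, u|exact: step].
by lra.
Qed.

End Net.

(** * Exponential moments of a centered variable *)

Section ExponentialMoments.
Context {d : measure_display} {T : measurableType d} {R : realType} (P : probability T R).
Local Open Scope ereal_scope.

(** The term of degree 1 keeps its sign, because it is the one that vanishes in
    expectation for a centered variable. *)
Lemma expR_le_nneseries (y : R) :
  (expR y)%:E <= (1 + y)%:E + \sum_(k <oo) (`|y| ^+ k.+2 / k.+2`!%:R)%:E.
Proof.
pose a k : \bar R := (`|y| ^+ k.+2 / k.+2`!%:R)%:E; set S := \sum_(k <oo) _.
have a0 k : 0 <= a k by rewrite lee_fin divr_ge0// exprn_ge0.
have S0 : 0 <= S by apply: nneseries_ge0 => k _ _; exact: a0.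
have partial N : (series (exp_coeff y) N.+2)%:E <= (1 + y)%:E + S.
  rewrite /series/= big_nat_recl// big_nat_recl// addrA EFinD.
  rewrite /exp_coeff/= expr0 expr1 !divr1; apply: leeD2l.
  apply: (@le_trans _ _ (\sum_(0 <= k < N) a k)).
    rewrite sumEFin lee_fin; apply: ler_sum => k _.
    by rewrite ler_wpM2r// -normrX ler_norm.
  by apply: nneseries_lim_ge => k *; exact: (a0 k).
move: partial; case: S S0 => [s s0 partial| |//]; last by rewrite addey// => *; exact: leey.
rewrite -EFinD lee_fin; apply: limr_le; first exact: is_cvg_series_exp_coeff.
by exists 2%N => // -[|[|N]]//= _; have := partial N; rewrite -EFinD lee_fin.
Qed.

(** The terms of degree at least 2 of the Taylor series are integrated one by
    one, and [A * q ^+ 2 + A * q ^+ 3 + ...] is at most [2 * A * q ^+ 2].  As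
    monotonicity of the integral is used for nonnegative functions, [`|Y| - Y]
    is added to both sides; its integral is finite and equal to that of
    [`|Y|], since [Y] is centered. *)
Lemma expectation_expR_le (Y : T -> R) (A q : R) :
  P.-integrable setT (EFin \o Y) -> \int[P]_w (Y w)%:E = 0 ->
  (0 <= A)%R -> (0 <= q <= 2^-1)%R ->
  (forall k, (2 <= k)%N -> \int[P]_w (`|Y w| ^+ k)%:E <= (A * q ^+ k * k`!%:R)%:E) ->
  \int[P]_w (expR (Y w))%:E <= (1 + 2 * A * q ^+ 2)%:E.
Proof.
move=> iY Y0 A0 /andP[q0 q2] hY.
have mY : measurable_fun setT Y by apply/measurable_EFinP; exact: measurable_int iY.
pose a k w : \bar R := (`|Y w| ^+ k.+2 / k.+2`!%:R)%:E.
have a0 k w : 0 <= a k w by rewrite lee_fin divr_ge0// exprn_ge0.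
have ma k : measurable_fun setT (a k).
  apply/measurable_EFinP; apply: measurable_funM => //; apply: measurable_funX.
  exact: measurableT_comp.
pose g w := \sum_(k <oo) a k w.
have g0 w : 0 <= g w by apply: nneseries_ge0 => k _ _; exact: a0.
have mg : measurable_fun setT g by apply: ge0_emeasurable_sum => k *.
have gle : \int[P]_w g w <= (2 * A * q ^+ 2)%:E.
  rewrite /g integral_nneseries//.
  apply: lime_le.
    by apply: is_cvg_nneseries => k _ _; apply: integral_ge0 => w _; exact: a0.
  apply: nearW => N.
  apply: (@le_trans _ _ (\sum_(0 <= k < N) (A * q ^+ 2 * q ^+ k)%:E)).
    apply: lee_sum => k _.
    rewrite (_ : \int[P]_w a k w = ((k.+2`!%:R)^-1)%:E * \int[P]_w (`|Y w| ^+ k.+2)%:E); last first.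
      rewrite -ge0_integralZl//.
      - by apply: eq_integral => w _; rewrite /a -EFinM mulrC.
      - by apply/measurable_EFinP; apply: measurable_funX; exact: measurableT_comp.
    apply: (@le_trans _ _ (((k.+2`!%:R)^-1)%:E * (A * q ^+ k.+2 * k.+2`!%:R)%:E)).
      by apply: lee_wpmul2l; [rewrite lee_fin invr_ge0 | exact: hY].
    rewrite -EFinM lee_fin mulrC mulfK ?gt_eqF ?ltr0n ?fact_gt0//.
    by rewrite -mulrA -exprD.
  rewrite sumEFin lee_fin -mulr_sumr mulrAC [leRHS]mulrAC -[leRHS]mulrA.
  rewrite mulrAC [X in (_ <= X)%R](_ : _ = A * q ^+ 2 * 2)%R; last by ring.
  apply: ler_wpM2l; first by rewrite mulr_ge0 ?sqr_ge0.
  (* Strengthened so as to be inductive. *)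
  suff : (\sum_(0 <= k < N) q ^+ k + 2 * q ^+ N <= 2)%R.
    by apply: le_trans; rewrite lerDl mulr_ge0 ?exprn_ge0.
  elim: N => [|N IH]; first by rewrite big_nil add0r expr0 mulr1.
  apply: le_trans IH; rewrite big_nat_recr//= -addrA lerD2l exprS.
  have : (0 <= q ^+ N)%R by rewrite exprn_ge0.
  nra.
pose n w := (`|Y w| - Y w)%R.
have n0 w : (0 <= n w)%R by rewrite subr_ge0 ler_norm.
have mn : measurable_fun setT n by apply: measurable_funB => //; exact: measurableT_comp.
have iYn : P.-integrable setT (fun w => (`|Y w|)%:E) by exact: integrable_norm.
pose b := \int[P]_w (`|Y w|)%:E.
have bfin : b \is a fin_num by exact: integrable_fin_num.
have nE : \int[P]_w (n w)%:E = b.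
  rewrite /n; under eq_integral do rewrite EFinB.
  by rewrite integralB// Y0 sube0.
have : \int[P]_w ((expR (Y w))%:E + (n w)%:E) <= \int[P]_w ((1 + `|Y w|)%:E + g w).
  apply: ge0_le_integral => //.
  - by move=> w _; rewrite -EFinD lee_fin addr_ge0 ?expR_ge0.
  - by apply/measurable_EFinP; apply: measurable_funD => //; exact: measurableT_comp.
  - apply: emeasurable_funD => //; apply/measurable_EFinP.
    by apply: measurable_funD => //; exact: measurableT_comp.
  move=> w _; apply: (@le_trans _ _ ((1 + Y w)%:E + g w + (n w)%:E)).
    by apply: leeD2r; exact: expR_le_nneseries.
  by rewrite addeAC -EFinD /n addrA addrAC addrK addrC.
have -> : \int[P]_w ((expR (Y w))%:E + (n w)%:E) = \int[P]_w (expR (Y w))%:E + b.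
  rewrite -nE ge0_integralD//.
  - by apply/measurable_EFinP; exact: measurableT_comp.
  - by move=> w _; rewrite lee_fin.
  - exact/measurable_EFinP.
have -> : \int[P]_w ((1 + `|Y w|)%:E + g w) = \int[P]_w (1 + `|Y w|)%:E + \int[P]_w g w.
  rewrite ge0_integralD//.
  - by apply/measurable_EFinP; apply: measurable_funD => //; exact: measurableT_comp.
have -> : \int[P]_w (1 + `|Y w|)%:E = 1 + b.
  under eq_integral do rewrite EFinD.
  rewrite ge0_integralD//; last first.
    by apply/measurable_EFinP; exact: measurableT_comp.
  by have := expectation_cst P 1%R; rewrite unlock => ->.
rewrite [leRHS]addeAC leeD2rE// => /le_trans; apply.
by rewrite EFinD; apply: leeD2l.
Qed.

End ExponentialMoments.

(** * Expectation of a product of independent variables *)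

Section Independence.
Context {d : measure_display} {T : measurableType d} {R : realType} (P : probability T R).
Local Open Scope ereal_scope.

Let mu : {measure set _ -> \bar R} := @lebesgue_measure R.
Let GR := measurableTypeR R.

Lemma indic_eq (U V : Type) (A : set U) (B : set V) x y :
  (A x <-> B y) -> \1_A x = \1_B y :> R.
Proof.
move=> AB; rewrite !indicE; have -> : (x \in A) = (y \in B); last by [].
by apply/idP/idP => /set_mem h; apply/mem_set; apply/AB.
Qed.

(** Layer-cake formula: [g w] is the length of [`[0, g w[], so by Tonelli the
    integral of [W * g] is the integral over [s >= 0] of that of [W] on the
    level set [s < g], where the hypothesis factors it. *)
Lemma integral_mul_of_levels (W g : T -> R) :
  measurable_fun setT W -> (forall w, 0 <= W w)%R ->
  measurable_fun setT g -> (forall w, 0 <= g w)%R ->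
  (forall B, measurable B ->
    \int[P]_w (W w * \1_(g @^-1` B) w)%:E = \int[P]_w (W w)%:E * P (g @^-1` B)) ->
  \int[P]_w (W w * g w)%:E = \int[P]_w (W w)%:E * \int[P]_w (g w)%:E.
Proof.
move=> mW W0 mg g0 h.
have levels (V : T -> R) : measurable_fun setT V -> (forall w, 0 <= V w)%R ->
    measurable_fun setT (fun s => \int[P]_w (V w * \1_`[0%R, g w[ s)%:E) /\
    \int[P]_w (V w * g w)%:E = \int[mu]_s \int[P]_w (V w * \1_`[0%R, g w[ s)%:E.
  move=> mV V0.
  pose f (p : T * GR) : \bar R := (V p.1 * \1_`[0%R, g p.1[ p.2)%:E.
  have f0 p : 0 <= f p by rewrite lee_fin mulr_ge0// indicE.
  have mg1 : measurable_fun setT (fun p : T * GR => g p.1).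
    exact: (measurableT_comp mg measurable_fst).
  have mf : measurable_fun setT f.
    apply/measurable_EFinP; apply: measurable_funM.
      exact: (measurableT_comp mV measurable_fst).
    rewrite (_ : (fun p => _) = \1_[set p : T * GR | (0 <= p.2 < g p.1)%R]); last first.
      by apply/funext => p; apply: indic_eq; rewrite /= in_itv.
    apply: measurable_indic.
    rewrite (_ : [set _ | _] = (fun p : T * GR => (0 <= p.2)%R) @^-1` [set true] `&`
       (fun p : T * GR => (p.2 < g p.1)%R) @^-1` [set true]); last first.
      by apply/seteqP; split => p /= => [/andP|/andP].
    apply: measurableI.
    - have m : measurable_fun setT (fun p : T * GR => (0 <= p.2)%R).
        exact: measurable_fun_ler.
      by rewrite -[X in measurable X]setTI; exact: m.
    - have m : measurable_fun setT (fun p : T * GR => (p.2 < g p.1)%R).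
        exact: measurable_fun_ltr.
      by rewrite -[X in measurable X]setTI; exact: m.
  split; first exact: (@measurable_fun_fubini_tonelli_G _ _ T GR R P f mf f0).
  rewrite -(@fubini_tonelli _ _ T GR R P mu f mf f0).
  apply: eq_integral => w _; rewrite /f/=.
  under eq_integral do rewrite EFinM.
  rewrite ge0_integralZl//; last by rewrite lee_fin.
  - rewrite integral_indic// setIT.
    have := lebesgue_measure_itv `[0%R, g w[; rewrite /= lte_fin => ->.
    case: ltgtP (g0 w) => // [gw _|<- _]; first by rewrite sube0 EFinM.
    by rewrite mulr0 mule0.
  - apply/measurable_EFinP; apply: measurable_indic; exact: measurable_itv.
have [_ ->] := levels W mW W0.
have [m1 h1] := levels (cst 1%R) (@measurable_cst _ _ _ _ _ _) (fun=> ler01).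
have -> : \int[P]_w (g w)%:E = \int[P]_w (cst 1%R w * g w)%:E.
  by apply: eq_integral => w _; rewrite mul1r.
rewrite h1 -ge0_integralZl//.
- apply: eq_integral => s _; have [s0|s0] := leP 0%R s.
    have E w : \1_`[0%R, g w[ s = \1_(g @^-1` `]s, +oo[) w :> R.
      by apply: indic_eq; rewrite /= !in_itv/= s0 andbT.
    under eq_integral do rewrite E.
    under [X in _ = _ * X]eq_integral do rewrite E mul1r.
    rewrite h// integral_indic ?setIT//.
    by rewrite -[X in measurable X]setTI; exact: mg.
  have E w : \1_`[0%R, g w[ s = 0%R :> R.
    by rewrite indicE memNset//= in_itv/= leNgt s0.
  under eq_integral do rewrite E mulr0.
  under [X in _ = _ * X]eq_integral do rewrite E mulr0.
  by rewrite integral0 mule0.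
- by move=> s _; apply: integral_ge0 => w _; rewrite lee_fin mulr_ge0// indicE.
- by apply: integral_ge0 => w _; rewrite lee_fin.
Qed.

(** Independence is the case where every [f i] is an indicator.  The indicators
    are replaced one at a time by general functions, and
    [integral_mul_of_levels] makes each replacement, because its hypothesis on
    the level sets is again an instance with one indicator more. *)
Lemma integral_prod_independent {d' : measure_display} {U : measurableType d'}
  (I : finType) (Y : I -> T -> U) (f : I -> U -> R) :
  (forall i, measurable_fun setT (Y i)) -> mutually_independent P Y ->
  (forall i, measurable_fun setT (f i)) -> (forall i y, 0 <= f i y)%R ->
  \int[P]_w (\prod_i f i (Y i w))%:E = \prod_i \int[P]_w (f i (Y i w))%:E.
Proof.
move=> mY indep.
(* [s] contains the indices whose function may fail to be an indicator. *)
suff : forall (s : seq I) (f : I -> U -> R),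
    (forall i, measurable_fun setT (f i)) -> (forall i y, 0 <= f i y)%R ->
    (forall i, i \notin s -> exists B, measurable B /\ f i = \1_B) ->
    \int[P]_w (\prod_i f i (Y i w))%:E = \prod_i \int[P]_w (f i (Y i w))%:E.
  by move=> h mf f0; apply: (h (enum I)) => // i; rewrite mem_enum.
elim => [|x s IH] {}f mf f0 fB.
  have /choice[B hB] i : exists B, measurable B /\ f i = \1_B by exact: fB.
  have mB i : measurable (Y i @^-1` B i).
    by rewrite -[X in measurable X]setTI; apply: mY => //; case: (hB i).
  have E w : (\prod_i f i (Y i w) =
      \1_(\bigcap_(i in [set` [set: I]%SET]) (Y i @^-1` B i)) w)%R.
    rewrite indicE; have [wB|wB] := boolP (w \in _).
      rewrite big1// => i _; case: (hB i) => _ ->.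
      by rewrite indicE mem_set//; move/set_mem: wB; apply; rewrite /= inE.
    suff [i wi] : exists i, ~ B i (Y i w).
      by rewrite (bigD1 i)//=; case: (hB i) => _ ->; rewrite indicE memNset// mul0r.
    apply/existsNP => h; move/negP: wB; apply; apply/mem_set => i _; exact: h.
  under eq_integral do rewrite E.
  rewrite integral_indic//; last first.
    by apply: fin_bigcap_measurable => // i _; exact: mB.
  rewrite setIT; transitivity (\prod_(i in [set: I]%SET) P (Y i @^-1` B i)).
    by apply: indep => i; case: (hB i).
  rewrite big_mkcond/=; apply: eq_bigr => i _; rewrite inE.
  case: (hB i) => _ ->.
  under eq_integral => w _ do rewrite (@indic_eq _ _ _ (Y i @^-1` B i) _ w)//.
  by rewrite integral_indic// setIT.
pose upd (g : U -> R) i := if i == x then g else f i.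
have updP (B : set U) : measurable B ->
    \int[P]_w (\1_B (Y x w) * \prod_(i | i != x) f i (Y i w))%:E =
    P (Y x @^-1` B) * \prod_(i | i != x) \int[P]_w (f i (Y i w))%:E.
  move=> mB; have := IH (upd \1_B).
  have -> : (fun w => (\prod_i upd \1_B i (Y i w))%:E) =
      (fun w => (\1_B (Y x w) * \prod_(i | i != x) f i (Y i w))%:E).
    apply/funext => w; rewrite (bigD1 x)//= /upd eqxx; congr (_ * _)%:E.
    by apply: eq_bigr => i /negbTE ->.
  move=> ->.
  - rewrite (bigD1 x)//= /upd eqxx; congr (_ * _); last first.
      by apply: eq_bigr => i /negbTE ->.
    under eq_integral => w _ do rewrite (@indic_eq _ _ _ (Y x @^-1` B) _ w)//.
    rewrite integral_indic ?setIT//.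
    by rewrite -[X in measurable X]setTI; exact: mY.
  - by move=> i; rewrite /upd; case: ifP => // _; exact: measurable_indic.
  - by move=> i y; rewrite /upd; case: ifP => // _; rewrite indicE.
  - move=> i si; rewrite /upd; case: eqP => [_|/eqP ix]; first by exists B.
    by apply: fB; rewrite inE (negbTE ix).
pose W w := (\prod_(i | i != x) f i (Y i w))%R.
have WE : \int[P]_w (W w)%:E = \prod_(i | i != x) \int[P]_w (f i (Y i w))%:E.
  have := updP setT measurableT; rewrite preimage_setT probability_setT mul1e => <-.
  by apply: eq_integral => w _; rewrite indicE mem_set// mul1r.
rewrite (bigD1 x)//= -WE muleC -integral_mul_of_levels.
- by apply: eq_integral => w _; rewrite (bigD1 x)//= mulrC.
- rewrite /W; under eq_fun do rewrite -big_filter.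
  by apply: measurable_prod => i _; exact: measurableT_comp.
- by move=> w; apply: prodr_ge0.
- exact: measurableT_comp.
- by [].
- move=> B mB; rewrite WE muleC.
  have mfB : measurable (f x @^-1` B) by rewrite -[X in measurable X]setTI; exact: mf.
  rewrite -[_ @^-1` B]/(Y x @^-1` (f x @^-1` B)) -updP//.
  apply: eq_integral => w _; rewrite mulrC; congr (_ * _)%:E.
Qed.

End Independence.

(** * Tail bounds for sums of independent variables *)

Section Scalars.
Context {R : realType}.

Lemma exprn_self_le (k : nat) : k%:R ^+ k <= expR 1 ^+ k * k`!%:R :> R.
Proof.
rewrite -ler_pdivrMr ?ltr0n ?fact_gt0// -expRM_natl mulr1.
case: k => [|k]; first by rewrite expr0 divr1 expR0.
by apply: le_trans (expR_ge1Dxn k _); rewrite ?lerDr ?ler0n.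
Qed.

Lemma fact_le_exprn_self (k : nat) : (k`! <= k ^ k)%N.
Proof.
elim: k => // k IH; rewrite factS expnS leq_mul2l/=.
by apply: leq_trans IH _; case: k => // k; rewrite leq_exp2r.
Qed.

Lemma powR_exprn (x a : R) k : 0 <= x -> (x `^ a) ^+ k = (x ^+ k) `^ a.
Proof. by move=> x0; rewrite -!powR_mulrn ?powR_ge0// powRAC. Qed.

(** Since [k ^+ k <= e ^+ k * k`!] and [k `^ (k * p)] is the quotient of
    [k ^+ k] by [k `^ (k * (1 - p))], it suffices that [(w / k) ^+ k] raised to
    the power [1 - p] be at most [expR w].  Now
    [(w / k) ^+ k <= w ^+ k / k`! <= expR w], and [1 - p] lies between 0 and 1
    while [expR w >= 1]. *)
Lemma moment_growth (w p : R) (k : nat) : 0 <= w -> 0 <= p <= 1 -> (0 < k)%N ->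
  (w `^ (1 - p)) ^+ k * k%:R `^ (k%:R * p) <= expR w * (expR 1 ^+ k * k`!%:R).
Proof.
move=> w0 /andP[p0 p1] k0; have g0 : 0 <= 1 - p by rewrite subr_ge0.
have K0 : 0 < k%:R :> R by rewrite ltr0n.
apply: (@le_trans _ _ (expR w * k%:R ^+ k)); last first.
  by rewrite ler_wpM2l ?expR_ge0// exprn_self_le.
have -> : k%:R ^+ k = k%:R `^ (k%:R * p) * (k%:R ^+ k) `^ (1 - p) :> R.
  rewrite -(powR_mulrn k (ltW K0)) -powRrM -powRD; last by apply/implyP => _; rewrite gt_eqF.
  by rewrite -mulrDr addrC subrK mulr1.
rewrite mulrCA mulrC ler_wpM2l ?powR_ge0// powR_exprn//.
apply: (@le_trans _ _ ((expR w * k%:R ^+ k) `^ (1 - p))).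
  apply: ge0_ler_powR => //; rewrite ?nnegrE ?mulr_ge0 ?exprn_ge0 ?expR_ge0//.
  apply: (@le_trans _ _ (expR w * k`!%:R)).
    rewrite -ler_pdivrMr ?ltr0n ?fact_gt0//.
    case: k k0 K0 => // k _ _.
    by apply: le_trans (expR_ge1Dxn k w0); rewrite lerDr.
  by rewrite ler_wpM2l ?expR_ge0// -natrX ler_nat fact_le_exprn_self.
rewrite powRM ?expR_ge0 ?exprn_ge0// ler_wpM2r ?powR_ge0//.
by rewrite ler1_powR ?lerBlDl ?lerDr//; apply: le_trans (expR_ge1Dx w); rewrite lerDl.
Qed.

End Scalars.

Section Tails.
Context {d d' : measure_display} {T : measurableType d} {U : measurableType d'}.
Context {R : realType} (P : probability T R) (n : nat) (Y : 'I_n -> T -> U).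
Hypotheses (mY : forall i, measurable_fun setT (Y i)) (indep : mutually_independent P Y).

(** Chernoff's bound for a sum: independence turns the exponential moment into a
    product of [n] factors, each at most [expR b]. *)
Lemma independent_chernoff (z : 'I_n -> U -> R) (l b a : R) : 0 < l ->
  (forall i, measurable_fun setT (z i)) ->
  (forall i, (\int[P]_w (expR (l * z i (Y i w)))%:E <= (expR b)%:E)%E) ->
  (P [set w | (a <= \sum_i z i (Y i w))%R] <= (expR (n%:R * b - l * a))%:E)%E.
Proof.
move=> l0 mz hb; pose S w := \sum_i z i (Y i w).
have mS : measurable_fun setT S by apply: measurable_sum => i; exact: measurableT_comp.
pose S' : {mfun T >-> R} := HB.pack S (isMeasurableFun.Build _ _ _ _ S mS).
apply: (le_trans (chernoff (P := P) S' a l0)).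
rewrite expRD EFinM lee_wpmul2r ?lee_fin ?expR_ge0// /mmt_gen_fun unlock.
have -> : (\int[P]_w ((expR \o l \o* S') w)%:E =
    \int[P]_w (\prod_i expR (l * z i (Y i w)))%:E)%E.
  by apply: eq_integral => w _; rewrite -expR_sum /= -mulr_sumr mulrC.
rewrite (integral_prod_independent (f := fun i y => expR (l * z i y)) mY indep).
- have [_] : (0 <= \prod_i \int[P]_w (expR (l * z i (Y i w)))%:E /\
      \prod_i \int[P]_w (expR (l * z i (Y i w)))%:E <= \prod_(i < n) (expR b)%:E)%E.
    apply: (big_ind2 (fun x y : \bar R => 0 <= x /\ x <= y)%E) => //.
      by move=> x1 x2 y1 y2 [? ?] [? ?]; split; [exact: mule_ge0|exact: lee_pmul].
    by move=> i _; split; [apply: integral_ge0 => w _; rewrite lee_fin expR_ge0|exact: hb].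
  by rewrite prodEFin prodr_const card_ord -expRM_natl.
- by move=> i; apply: measurableT_comp => //; exact: measurable_funM.
- by move=> i y; exact: expR_ge0.
Qed.

Section OneVector.
Variables (z : 'I_n -> U -> R) (alpha sigma L : R).
Hypotheses (mz : forall i, measurable_fun setT (z i)) (alpha1 : 1 <= alpha)
  (sigma0 : 0 < sigma) (sigmaL : sigma <= L)
  (iz : forall i, P.-integrable setT (fun w => (z i (Y i w))%:E))
  (z0 : forall i, (\int[P]_w (z i (Y i w))%:E = 0)%E)
  (zk : forall i k, (2 <= k)%N ->
    (\int[P]_w (`|z i (Y i w)| ^+ k)%:E <=
      (k%:R `^ (k%:R / alpha) * sigma ^+ 2 * L ^+ (k - 2))%:E)%E).

Let L0 : 0 < L := lt_le_trans sigma0 sigmaL.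

(** The two tail bounds below differ only in [l] and in the geometric majorant
    [A * q ^+ k] of the moments, divided by [k`!], of [l * z]. *)
Lemma exp_moment_le (l A q : R) i : 0 < l -> 0 <= A -> 0 <= q <= 2^-1 ->
  (forall k, (2 <= k)%N ->
    l ^+ k * (k%:R `^ (k%:R / alpha) * sigma ^+ 2 * L ^+ (k - 2)) <= A * q ^+ k * k`!%:R) ->
  (\int[P]_w (expR (l * z i (Y i w)))%:E <= (1 + 2 * A * q ^+ 2)%:E)%E.
Proof.
move=> l0 A0 q0 h; apply: expectation_expR_le => //.
- exact: (integrableZl measurableT l (iz i)).
- by under eq_integral do rewrite EFinM; rewrite integralZl// z0 mule0.
move=> k k2.
apply: (@le_trans _ _
    (l ^+ k * (k%:R `^ (k%:R / alpha) * sigma ^+ 2 * L ^+ (k - 2)))%:E); last first.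
  by rewrite lee_fin; exact: h.
under eq_integral do rewrite normrM exprMn (gtr0_norm l0) EFinM.
rewrite ge0_integralZl//.
- by rewrite EFinM; apply: lee_wpmul2l; [rewrite lee_fin exprn_ge0// ltW|exact: zk].
- apply/measurable_EFinP; apply: measurable_funX; apply: measurableT_comp => //.
  exact: measurableT_comp.
- by rewrite lee_fin exprn_ge0// ltW.
Qed.

(** Bernstein regime: since [alpha >= 1] and [k ^+ k <= e ^+ k * k`!], the
    moments are dominated by a geometric series of ratio [e * l * L]. *)
Lemma bernstein_tail (s : R) : 0 < s -> (0 < n)%N ->
  (P [set w | (18 * expR 1 * (sigma * Num.sqrt (n%:R * s) + L * s)
        <= \sum_i z i (Y i w))%R] <= (expR (- (7 * s)))%:E)%E.
Proof.
move=> s0 n0; set e := expR 1; have e0 : 0 < e := expR_gt0 1.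
have N0 : 0 < n%:R :> R by rewrite ltr0n.
pose r := Num.sqrt (s / n%:R); have r0 : 0 < r by rewrite sqrtr_gt0 divr_gt0.
have r2 : n%:R * r ^+ 2 = s.
  by rewrite sqr_sqrtr ?divr_ge0 ?(ltW s0) ?(ltW N0)// mulrC divfK ?gt_eqF.
have nr : Num.sqrt (n%:R * s) = n%:R * r.
  by rewrite -r2 mulrA -expr2 -exprMn sqrtr_sqr ger0_norm// mulr_ge0// ltW.
(* The second value minimizes, up to a constant, the exponent that
   Chernoff's bound gives for Gaussian moments; the first one is a cutoff that
   keeps the ratio [e * l * L] at most 1/2. *)
pose l := Num.min (2 * e * L)^-1 (r / (e * sigma)).
have l0 : 0 < l by rewrite lt_min invr_gt0 divr_gt0 ?mulr_gt0.
have [e_ge0 l_ge0 L_ge0] := And3 (ltW e0) (ltW l0) (ltW L0).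
have [sigma_ge0 s_ge0 r_ge0] := And3 (ltW sigma0) (ltW s0) (ltW r0).
have l1 : l * (2 * e * L) <= 1.
  by rewrite -ler_pdivlMr ?mulr_gt0// mul1r ge_min lexx.
have l2 : l * (e * sigma) <= r.
  by rewrite -ler_pdivlMr ?mulr_gt0// ge_min lexx orbT.
have hb i : (\int[P]_w (expR (l * z i (Y i w)))%:E <= (expR (2 * (r ^+ 2)))%:E)%E.
  apply: (le_trans (exp_moment_le (A := (sigma / L) ^+ 2) (q := e * l * L) i l0 _ _ _)).
  - exact: sqr_ge0.
  - by rewrite !mulr_ge0//= -[2^-1]mul1r ler_pdivlMr//; lra.
  - move=> k k2.
    have hk : k%:R `^ (k%:R / alpha) <= e ^+ k * k`!%:R.
      apply: le_trans (exprn_self_le k); rewrite -powR_mulrn//.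
      apply: ler_powR; first by rewrite ler1n (leq_trans _ k2).
      by rewrite ler_pdivrMr ?(lt_le_trans ltr01)// ler_peMr.
    have -> : (sigma / L) ^+ 2 * (e * l * L) ^+ k * k`!%:R =
        l ^+ k * (e ^+ k * k`!%:R * sigma ^+ 2 * L ^+ (k - 2)).
      have hL : L ^+ k = L ^+ 2 * L ^+ (k - 2) by rewrite -exprD subnKC.
      by rewrite !exprMn exprVn hL; field; exact: lt0r_neq0.
    by rewrite ler_wpM2l ?exprn_ge0// !ler_wpM2r ?exprn_ge0 ?sqr_ge0.
  rewrite lee_fin; apply: le_trans (expR_ge1Dx _); rewrite lerD2l.
  have -> : 2 * (sigma / L) ^+ 2 * (e * l * L) ^+ 2 = 2 * (l * (e * sigma)) ^+ 2.
    by field; exact: lt0r_neq0.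
  by rewrite ler_wpM2l// ler_pXn2r// ?nnegrE// !mulr_ge0.
apply: (le_trans (independent_chernoff _ l0 mz hb)).
rewrite lee_fin ler_expR nr.
(* The exponential moments cost [2 * s], so [9 * s] leaves [7 * s]. *)
suff : 9 * s <= l * (18 * e * (sigma * (n%:R * r) + L * s)).
  have -> : n%:R * (2 * r ^+ 2) = 2 * s by rewrite mulrCA r2.
  lra.
rewrite {1}/l; case: (leP (2 * e * L)^-1 (r / (e * sigma))) => _.
- have -> : (2 * e * L)^-1 * (18 * e * (sigma * (n%:R * r) + L * s)) =
      9 * s + 9 * (sigma * (n%:R * r)) / L.
    by field; rewrite !gt_eqF.
  by rewrite lerDl divr_ge0 ?mulr_ge0.
- have -> : r / (e * sigma) * (18 * e * (sigma * (n%:R * r) + L * s)) =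
      18 * (n%:R * r ^+ 2) + 18 * r * L * s / sigma.
    by field; rewrite !gt_eqF.
  rewrite r2; have : 0 <= 18 * r * L * s / sigma by rewrite divr_ge0 ?mulr_ge0.
  lra.
Qed.

(** Large-deviation regime [w = s / n >= 1]: the choice
    [l = w `^ (1 - 1/alpha) / (2 e L)] makes every exponential moment at most
    [expR (2 * w)], hence their product at most [expR (2 * s)]. *)
Lemma large_deviation_tail (s : R) : (0 < n)%N -> n%:R <= s ->
  (P [set w | (18 * expR 1 * (L * n%:R * (s / n%:R) `^ alpha^-1)
        <= \sum_i z i (Y i w))%R] <= (expR (- (7 * s)))%:E)%E.
Proof.
move=> n0 ns; set e := expR 1; have e0 : 0 < e := expR_gt0 1.
have N0 : 0 < n%:R :> R by rewrite ltr0n.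
pose w := s / n%:R; have w1 : 1 <= w by rewrite ler_pdivlMr// mul1r.
have w0 : 0 < w := lt_le_trans ltr01 w1.
have nw : n%:R * w = s by rewrite mulrC divfK ?gt_eqF.
have a0 : 0 < alpha := lt_le_trans ltr01 alpha1.
have pbnd : 0 <= alpha^-1 <= 1 by rewrite invr_ge0 (ltW a0)/= invf_le1.
pose l := w `^ (1 - alpha^-1) / (2 * e * L).
have l0 : 0 < l by apply: divr_gt0; [exact: powR_gt0|rewrite !mulr_gt0].
have hb i : (\int[P]_w' (expR (l * z i (Y i w')))%:E <= (expR (2 * w))%:E)%E.
  apply: (le_trans (exp_moment_le (A := expR w) (q := 2^-1) i l0 _ _ _)).
  - exact: expR_ge0.
  - by rewrite lexx invr_ge0 ler0n.
  - move=> k k2.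
    have hk := moment_growth (ltW w0) pbnd (ltnW k2).
    apply: (@le_trans _ _ (l ^+ k * (k%:R `^ (k%:R / alpha) * L ^+ k))).
      rewrite ler_wpM2l ?exprn_ge0 ?(ltW l0)// -mulrA ler_wpM2l ?powR_ge0//.
      rewrite -{2}(subnKC k2) exprD ler_wpM2r ?exprn_ge0 ?(ltW L0)//.
      by rewrite ler_pXn2r// ?nnegrE ltW.
    have -> : l ^+ k * (k%:R `^ (k%:R / alpha) * L ^+ k) =
       (w `^ (1 - alpha^-1)) ^+ k * k%:R `^ (k%:R / alpha) * ((2 * e) ^+ k)^-1.
      rewrite /l !exprMn exprVn !exprMn; field.
      by rewrite !expf_neq0 ?gt_eqF.
    rewrite ler_pdivrMr ?exprn_gt0 ?mulr_gt0//; apply: le_trans hk _.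
    rewrite le_eqVlt; apply/orP; left; apply/eqP.
    rewrite exprMn exprVn; field; exact: expf_neq0.
  rewrite lee_fin.
  have x2 : 2 <= expR w by apply: le_trans (expR_ge1Dx w); lra.
  have -> : expR (2 * w) = expR w ^+ 2 by rewrite expRM_natl.
  nra.
apply: (le_trans (independent_chernoff _ l0 mz hb)).
rewrite lee_fin ler_expR mulrCA nw -/w.
have -> : l * (18 * e * (L * n%:R * w `^ alpha^-1)) = 9 * s.
  have E : w `^ (1 - alpha^-1) * w `^ alpha^-1 = w.
    rewrite -powRD; last by apply/implyP => _; rewrite gt_eqF.
    by rewrite subrK powRr1// ltW.
  transitivity (9 * n%:R * (w `^ (1 - alpha^-1) * w `^ alpha^-1)).
    by rewrite /l; field; rewrite !gt_eqF.
  by rewrite E -mulrA nw.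
lra.
Qed.

End OneVector.
End Tails.

(** * Second moments of the rows *)

Section RowMoments.
Context {d : measure_display} {T : measurableType d} {R : realType} (P : probability T R).

(** The number [m] is arbitrary, so the lemma applies with the junk value that
    [fine] gives to an expectation not yet known to be finite. *)
Lemma integrable_of_centered_sqr (V : T -> R) m c : measurable_fun setT V ->
  (\int[P]_w (`|V w - m| ^+ 2)%:E <= c%:E)%E -> P.-integrable setT (EFin \o V).
Proof.
move=> mV hV.
have mVm : measurable_fun setT (fun w => (`|V w - m| ^+ 2)).
  by apply: measurable_funX; apply: measurableT_comp => //; exact: measurable_funB.
apply: (@le_integrable _ _ _ P _ measurableT _
    ((fun=> (`|m| + 1)%R%:E) \+ (fun w => (`|V w - m| ^+ 2)%R%:E))%E).
- exact/measurable_EFinP.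
- move=> w _ /=; rewrite lee_fin [leRHS]ger0_norm ?addr_ge0 ?exprn_ge0//.
  have := ler_normD m (V w - m); have -> : m + (V w - m) = V w by ring.
  have := sqr_ge0 (`|V w - m| - 1); nra.
apply: integrableD => //; first exact: finite_measure_integrable_cst.
apply/integrableP; split; first exact/measurable_EFinP.
under eq_integral do rewrite gee0_abs ?lee_fin ?exprn_ge0//.
exact: le_lt_trans hV (ltry _).
Qed.

Context {d1 d2 : nat} (X : T -> 'M[R]_(d1, d2)).
Hypothesis mX : random_matrix X.

Lemma row_formE i u w : row_form X i u w = \sum_j X w i j * u j 0.
Proof. by rewrite /row_form mxE; apply: eq_bigr => j _; rewrite mxE. Qed.

Lemma measurable_row_form i u : measurable_fun setT (row_form X i u).
Proof.
rewrite (_ : row_form X i u = fun w => \sum_j X w i j * u j 0).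
  by apply: measurable_sum => j; apply: measurable_funM => //; exact: mX.
by apply/funext => w; exact: row_formE.
Qed.

Lemma measurable_row_tuple i : measurable_fun setT (row_tuple X i).
Proof.
apply/measurable_fun_tnthP => j.
rewrite (_ : _ \o _ = fun w => X w i j); first exact: mX.
by apply/funext => w; rewrite /= tnth_mktuple.
Qed.

Hypothesis iV : forall i u, sphere u ->
  P.-integrable setT (fun w => (row_form X i u w ^+ 2)%:E).

(** Squares of entries are squares of linear forms in coordinate vectors, and
    they dominate the products. *)
Lemma integrable_entry_prod i j k : P.-integrable setT (fun w => (X w i j * X w i k)%:E).
Proof.
have iX l : P.-integrable setT (fun w => (X w i l ^+ 2)%:E).
  pose e : 'cV[R]_d2 := \col_m (m == l)%:R.
  have e1 : sphere e.
    apply/sphereE; rewrite /sqnorm (bigD1 l)//= mxE eqxx expr1n big1 ?addr0//.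
    by move=> m /negbTE ml; rewrite mxE ml expr0n.
  have -> : (fun w => (X w i l ^+ 2)%:E) = (fun w => (row_form X i e w ^+ 2)%:E).
    apply/funext => w; rewrite row_formE (bigD1 l)//= mxE eqxx mulr1 big1 ?addr0//.
    by move=> m /negbTE ml; rewrite mxE ml mulr0.
  exact: iV.
apply: (@le_integrable _ _ _ P _ measurableT _
    ((fun w => (X w i j ^+ 2)%:E) \+ (fun w => (X w i k ^+ 2)%:E))%E).
- by apply/measurable_EFinP; apply: measurable_funM; exact: mX.
- move=> w _ /=; rewrite lee_fin [leRHS]ger0_norm ?addr_ge0 ?sqr_ge0// normrM.
  rewrite -(real_normK (num_real (X w i j))) -(real_normK (num_real (X w i k))).
  have := sqr_ge0 (`|X w i j| - `|X w i k|); have := sqr_ge0 (`|X w i j| + `|X w i k|).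
  nra.
by apply: integrableD => //; exact: iX.
Qed.

Lemma integral_row_form_sqr i u :
  (\int[P]_w (row_form X i u w ^+ 2)%:E = (qform (second_moment P X i) u)%:E)%E.
Proof.
have E w : (row_form X i u w ^+ 2)%:E =
    (\sum_j \sum_k (u j 0 * u k 0)%:E * (X w i j * X w i k)%:E)%E.
  under eq_bigr do under eq_bigr do rewrite -EFinM.
  under eq_bigr do rewrite sumEFin.
  rewrite sumEFin; congr EFin; rewrite row_formE expr2 mulr_suml.
  apply: eq_bigr => j _; rewrite mulr_sumr; apply: eq_bigr => k _; ring.
under eq_integral do rewrite E.
rewrite integral_sum//; last first.
  move=> j; apply: integrable_sum => // k _; apply: integrableZl => //.
  exact: integrable_entry_prod.
rewrite qform_sum -sumEFin; apply: eq_bigr => j _.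
rewrite integral_sum//; last first.
  by move=> k; apply: integrableZl => //; exact: integrable_entry_prod.
rewrite -sumEFin; apply: eq_bigr => k _.
rewrite integralZl//; last exact: integrable_entry_prod.
rewrite mxE unlock -[(\int[P]_w _)%E in LHS]fineK.
  by rewrite -EFinM; congr EFin; ring.
by apply: integrable_fin_num => //; exact: integrable_entry_prod.
Qed.

Lemma sum_row_form_sqr u w : \sum_i row_form X i u w ^+ 2 = sqnorm (X w *m u).
Proof.
by apply: eq_bigr => i _; rewrite row_formE [in RHS]mxE.
Qed.

End RowMoments.

Section UnionBound.
Context {d : measure_display} {T : measurableType d} {R : realType} (P : probability T R).

Lemma union_bound (I : eqType) (s : seq I) (A : I -> set T) (b : R) :
  (forall i, i \in s -> measurable (A i) /\ (P (A i) <= b%:E)%E) ->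
  measurable [set w | exists2 i, i \in s & A i w] /\
  (P [set w | exists2 i, i \in s & A i w] <= ((size s)%:R * b)%:E)%E.
Proof.
elim: s => [|x s IH] h.
  have -> : [set w | exists2 i, i \in [::] & A i w] = set0.
    by apply/seteqP; split => w //= [i].
  by split => //; rewrite measure0 mul0r.
have -> : [set w | exists2 i, i \in x :: s & A i w] =
    A x `|` [set w | exists2 i, i \in s & A i w].
  apply/seteqP; split => w /=.
    by move=> [i]; rewrite inE => /predU1P[->|si] Ai; [left|right; exists i].
  by move=> [Ax|[i si Ai]]; [exists x; rewrite ?mem_head|exists i; rewrite ?inE ?si ?orbT].
have [m1 p1] := h x (mem_head _ _).
have [m2 p2] : measurable [set w | exists2 i, i \in s & A i w] /\
  (P [set w | exists2 i, i \in s & A i w] <= ((size s)%:R * b)%:E)%E.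
  by apply: IH => i si; apply: h; rewrite inE si orbT.
split; first exact: measurableU.
apply: le_trans (measureU2 _ m1 m2) _ => /=.
by rewrite -natr1 mulrDl mul1r addrC EFinD; exact: leeD.
Qed.

End UnionBound.

(** * Deviation of the extreme singular values *)

Section SingularValueDeviation.
Context {d : measure_display} {T : measurableType d} {R : realType} (P : probability T R).
Context (d1 d2 : nat) (X : T -> 'M[R]_(d1, d2)) (Sigma : 'M[R]_d2) (alpha sigma L : R).
Hypotheses (d1_gt0 : (0 < d1)%N) (d2_gt0 : (0 < d2)%N) (alpha1 : 1 <= alpha)
  (sigma0 : 0 < sigma) (sigmaL : sigma <= L)
  (mX : random_matrix X) (indep : mutually_independent P (row_tuple X)).
Hypothesis moments : forall (i : 'I_d1) (u : 'cV[R]_d2) (k : nat), sphere u -> (2 <= k)%N ->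
  ('E_P[fun w => (`|row_form X i u w ^+ 2
                    - fine 'E_P[fun w' => row_form X i u w' ^+ 2]| ^+ k)%R]
      <= (k%:R `^ (k%:R / alpha) * sigma ^+ 2 * L ^+ (k - 2))%R%:E)%E.
Hypothesis SigmaE : forall i : 'I_d1, Sigma = second_moment P X i.

(** A function of the row, rather than of the sample point, so that independence
    of the rows applies to it. *)
Definition centered_square (u : 'cV[R]_d2) (i : 'I_d1) (y : d2.-tuple R) : R :=
  (\sum_j tnth y j * u j 0) ^+ 2 - qform Sigma u.

Lemma measurable_centered_square u i : measurable_fun setT (centered_square u i).
Proof.
apply: measurable_funB => //; apply: measurable_funX; apply: measurable_sum => j.
by apply: measurable_funM => //; exact: measurable_tnth.
Qed.

Lemma centered_square_row u i w :
  centered_square u i (row_tuple X i w) = row_form X i u w ^+ 2 - qform Sigma u.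
Proof.
rewrite /centered_square row_formE; congr (_ ^+ 2 - _).
by apply: eq_bigr => j _; rewrite tnth_mktuple.
Qed.

Lemma integrable_row_form_sqr i u : sphere u ->
  P.-integrable setT (fun w => (row_form X i u w ^+ 2)%:E).
Proof.
move=> su; have := moments i su (leqnn 2); rewrite unlock.
apply: integrable_of_centered_sqr.
by apply: measurable_funX; exact: measurable_row_form.
Qed.

Lemma expectation_row_form_sqr i u :
  (\int[P]_w (row_form X i u w ^+ 2)%:E = (qform Sigma u)%:E)%E.
Proof.
by rewrite (SigmaE i); apply: integral_row_form_sqr => // *; exact: integrable_row_form_sqr.
Qed.

Lemma centered_square_integrable i u : sphere u ->
  P.-integrable setT (fun w => (centered_square u i (row_tuple X i w))%:E).
Proof.
move=> su; under eq_fun do rewrite centered_square_row EFinB.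
apply: integrableB => //; first exact: integrable_row_form_sqr.
exact: finite_measure_integrable_cst.
Qed.

Lemma centered_square_mean i u : sphere u ->
  (\int[P]_w (centered_square u i (row_tuple X i w))%:E = 0)%E.
Proof.
move=> su; under eq_integral do rewrite centered_square_row EFinB.
rewrite integralB//; first last.
- exact: finite_measure_integrable_cst.
- exact: integrable_row_form_sqr.
have := expectation_cst P (qform Sigma u); rewrite unlock => ->.
by rewrite expectation_row_form_sqr subee.
Qed.

Lemma centered_square_moments i u k : sphere u -> (2 <= k)%N ->
  (\int[P]_w (`|centered_square u i (row_tuple X i w)| ^+ k)%:E <=
      (k%:R `^ (k%:R / alpha) * sigma ^+ 2 * L ^+ (k - 2))%:E)%E.
Proof.
move=> su k2; have := moments i su k2; rewrite unlock expectation_row_form_sqr /=.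
by under [X in _ -> (X <= _)%E]eq_integral do rewrite centered_square_row.
Qed.

(** The factor 7 pays for the union bound over the net:
    [2 * 2 ^ (6 * d2) <= expR (7 * d2)]. *)
Definition two_sided_tail (s x : R) := forall u : 'cV[R]_d2, sphere u ->
  (P [set w | (x <= \sum_i centered_square u i (row_tuple X i w))%R] <= (expR (- (7 * s)))%:E /\
   P [set w | (x <= \sum_i - centered_square u i (row_tuple X i w))%R] <= (expR (- (7 * s)))%:E)%E.

Let negated_moments (i : 'I_d1) (u : 'cV[R]_d2) : sphere u ->
  [/\ P.-integrable setT (fun w => (- centered_square u i (row_tuple X i w))%:E),
      (\int[P]_w (- centered_square u i (row_tuple X i w))%:E = 0)%E &
      forall k, (2 <= k)%N -> (\int[P]_w (`|- centered_square u i (row_tuple X i w)| ^+ k)%:E <=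
      (k%:R `^ (k%:R / alpha) * sigma ^+ 2 * L ^+ (k - 2))%:E)%E].
Proof.
move=> su; split.
- under eq_fun do rewrite EFinN; apply: integrableN => //.
  exact: centered_square_integrable.
- under eq_integral do rewrite EFinN; rewrite integralN.
    by rewrite centered_square_mean// oppe0.
  by apply: integrable_add_def => //; exact: centered_square_integrable.
- move=> k k2; under eq_integral do rewrite normrN.
  exact: centered_square_moments.
Qed.

Lemma bernstein_two_sided (s : R) : 0 < s ->
  two_sided_tail s (18 * expR 1 * (sigma * Num.sqrt (d1%:R * s) + L * s)).
Proof.
move=> s0 u su; have mY := measurable_row_tuple mX; split.
- apply: (bernstein_tail mY indep (z := centered_square u) _ alpha1) => // *.
  + exact: measurable_centered_square.
  + exact: centered_square_integrable.
  + exact: centered_square_mean.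
  + exact: centered_square_moments.
- apply: (bernstein_tail mY indep (z := fun i y => - centered_square u i y) _ alpha1) => //.
  + by move=> i; apply: measurable_funN; exact: measurable_centered_square.
  + by move=> i; have [] := negated_moments i su.
  + by move=> i; have [] := negated_moments i su.
  + by move=> i k k2; have [_ _] := negated_moments i su; apply.
Qed.

Lemma large_deviation_two_sided (s : R) : d1%:R <= s ->
  two_sided_tail s (18 * expR 1 * (L * d1%:R * (s / d1%:R) `^ alpha^-1)).
Proof.
move=> s0 u su; have mY := measurable_row_tuple mX; split.
- apply: (large_deviation_tail mY indep (z := centered_square u) (sigma := sigma) _ alpha1) => // *.
  + exact: measurable_centered_square.
  + exact: centered_square_integrable.
  + exact: centered_square_mean.
  + exact: centered_square_moments.
- apply: (large_deviation_tail mY indep (z := fun i y => - centered_square u i y)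
      (sigma := sigma) _ alpha1) => //.
  + by move=> i; apply: measurable_funN; exact: measurable_centered_square.
  + by move=> i; have [] := negated_moments i su.
  + by move=> i; have [] := negated_moments i su.
  + by move=> i k k2; have [_ _] := negated_moments i su; apply.
Qed.

Lemma Sigma_sym : Sigma^T = Sigma.
Proof.
rewrite (SigmaE (Ordinal d1_gt0)); apply/matrixP => j k; rewrite !mxE.
by congr (fine ('E_P[_])); apply/funext => w; rewrite mulrC.
Qed.

Lemma lambda_min_Sigma_ge0 : 0 <= lambda_min Sigma.
Proof.
rewrite /lambda_min; set S := [set _ | _].
have [/eqP->|/set0P S0] := boolP (S == set0); first by rewrite inf0.
apply: lb_le_inf => // a /eigenvalue_qform[u u1 <-].
rewrite -lee_fin -(expectation_row_form_sqr (Ordinal d1_gt0)).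
by apply: integral_ge0 => w _; rewrite lee_fin sqr_ge0.
Qed.

(** Outside the union of the bad events of the vectors of the net,
    [qform D] is at most [x] in absolute value on the net, hence at most [3 * x]
    on the sphere, and [sqnorm (X w *m u)] is [d1 * qform Sigma u + qform D u].
    The error [err] is kept separate from [3 * x] because the levels supplied by
    the tail bounds are only compared with it. *)
Lemma singular_values_deviation (t x err : R) : 0 < t -> 0 <= x -> 3 * x <= err ->
  two_sided_tail (d2%:R + t) x ->
  ((1 - expR (- t))%R%:E <=
      P [set w | (d1%:R * Num.sqrt (lambda_min Sigma) ^+ 2 - err <= s_min (X w) ^+ 2
                 /\ s_min (X w) ^+ 2 <= s_max (X w) ^+ 2
                 /\ s_max (X w) ^+ 2 <= d1%:R * Num.sqrt (lambda_max Sigma) ^+ 2 + err)%R])%E.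
Proof.
move=> t0 x0 xerr tail.
have [N [sN N1 hN]] := @sphere_net R d2.
pose dev u w := \sum_i centered_square u i (row_tuple X i w).
have mdev u : measurable_fun setT (dev u).
  apply: measurable_sum => i; apply: measurableT_comp; first exact: measurable_centered_square.
  exact: measurable_row_tuple.
have mge (f : T -> R) : measurable_fun setT f -> measurable [set w | x <= f w].
  move=> mf; rewrite (_ : [set w | _] = f @^-1` `[x, +oo[); last first.
    by apply/seteqP; split => w /=; rewrite in_itv/= andbT.
  by rewrite -[X in measurable X]setTI; exact: mf.
pose bad u := [set w | x <= dev u w] `|` [set w | x <= - dev u w].
have hbad u : u \in N ->
    measurable (bad u) /\ (P (bad u) <= (2 * expR (- (7 * (d2%:R + t))))%:E)%E.
  move=> uN; have [h1 h2] := tail u ((sphereE u).2 (N1 u uN)).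
  have m1 : measurable [set w | x <= dev u w] by exact: mge.
  have m2 : measurable [set w | x <= - dev u w] by apply: mge; exact: measurable_funN.
  split; first exact: measurableU.
  apply: (le_trans (measureU2 _ m1 m2)).
  rewrite (_ : 2 * _ = expR (- (7 * (d2%:R + t))) + expR (- (7 * (d2%:R + t)))); last by ring.
  rewrite EFinD; apply: leeD => //.
  by move: h2; under [X in P X]eq_set do rewrite sumrN.
have [mB pB] := union_bound hbad.
set B := [set w | _] in mB pB.
have pBt : (P B <= (expR (- t))%:E)%E.
  apply: (le_trans pB); rewrite lee_fin.
  have e2 : 2 <= expR 1 :> R by apply: le_trans (expR_ge1Dx 1).
  have h1 : (size N)%:R * 2 <= expR (7 * d2%:R) :> R.
    have h2 : (size N * 2 <= 2 ^ (7 * d2))%N.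
      apply: (@leq_trans (2 ^ (6 * d2) * 2)); first by rewrite leq_mul2r sN orbT.
      by rewrite -expnSr leq_exp2l// ltn_mul2r d2_gt0.
    apply: (@le_trans _ _ (2 ^ (7 * d2))%:R).
      by rewrite -natrM ler_nat.
    rewrite natrX -natrM -[(7 * d2)%:R]mulr1 expRM_natl.
    by apply: lerXn2r; rewrite ?nnegrE ?expR_ge0.
  rewrite mulrA; apply: (@le_trans _ _ (expR (7 * d2%:R) * expR (- (7 * (d2%:R + t))))).
    by rewrite ler_wpM2r ?expR_ge0.
  by rewrite -expRD ler_expR; lra.
set E := [set w | _].
have mE : measurable E by exact: measurable_singular_values_between.
suff BE : ~` B `<=` E.
  apply: (@le_trans _ _ (P (~` B))); last by apply: le_measure; rewrite ?inE//; exact: measurableC.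
  rewrite probability_setC// EFinB; exact: leeB.
move=> w wB; apply: singular_values_between => // u u1.
pose D := (X w)^T *m X w - d1%:R *: Sigma.
have Ds : D^T = D by rewrite /D linearB/= gram_sym linearZ/= Sigma_sym.
have DE v : qform D v = dev v w.
  rewrite /dev; under eq_bigr do rewrite centered_square_row.
  rewrite big_split/= sum_row_form_sqr sumr_const card_ord.
  rewrite /qform /bform /D mulmxBr mulmxBl mxE [X in _ + X]mxE.
  rewrite -scalemxAr -scalemxAl [X in _ - X]mxE mulNrn; congr (_ - _); last by rewrite mulr_natl.
  by rewrite -/(bform _ _ _) -/(qform _ _) qform_gram.
have hD : `|qform D u| <= 3 * x.
  apply: (hN D x Ds x0 _ u u1) => v vN; rewrite DE leNgt; apply/negP => xv; apply: wB.
  exists v => //; case: (leP 0 (dev v w)) => h.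
    by left => /=; move: xv; rewrite ger0_norm// => /ltW.
  by right => /=; move: xv; rewrite ltr0_norm// => /ltW.
have qE : sqnorm (X w *m u) = d1%:R * qform Sigma u + qform D u.
  rewrite DE /dev; under [in RHS]eq_bigr do rewrite centered_square_row.
  by rewrite big_split/= sum_row_form_sqr sumr_const card_ord mulNrn -[_ *+ d1]mulr_natl; ring.
have lmin := lambda_min_le_qform u d2_gt0 Sigma_sym.
have lmax := qform_le_lambda_max u d2_gt0 Sigma_sym.
rewrite u1 !mulr1 in lmin lmax.
have smin : Num.sqrt (lambda_min Sigma) ^+ 2 = lambda_min Sigma.
  by rewrite sqr_sqrtr// lambda_min_Sigma_ge0.
have smax : lambda_max Sigma <= Num.sqrt (lambda_max Sigma) ^+ 2.
  have [h|h] := leP 0 (lambda_max Sigma); first by rewrite sqr_sqrtr.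
  by apply: le_trans (sqr_ge0 _); exact: ltW.
have d1_ge0 : 0 <= d1%:R :> R by exact: ler0n.
have a1 := ler_wpM2l d1_ge0 lmin; have a2 := ler_wpM2l d1_ge0 (le_trans lmax smax).
move: hD; rewrite ler_norml qE smin => /andP[h1 h2].
by apply/andP; split; lra.
Qed.

End SingularValueDeviation.

(** For [n = d1] and [w = (d2 + t) / d1], the cases [p = 1/alpha] and [p = 1/2]
    give all error terms the common form [d1 * w `^ p]. *)
Lemma powRM_interpolate {R : realType} (n w p : R) : 0 < n -> 0 <= w ->
  (n * w) `^ p * n `^ (1 - p) = n * w `^ p.
Proof.
move=> n0 w0; rewrite powRM ?(ltW n0)// mulrAC -powRD; last first.
  by apply/implyP => _; rewrite gt_eqF.
by rewrite addrC subrK powRr1// ltW.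
Qed.

Unset Implicit Arguments.

(* MathComp-Analysis world. [beta] enters only through [beta^-1]; as [0^-1 = 0]
   in MathComp, [alpha = 1] forces [beta = 0], i.e. [beta^-1 = 0]. *)
Theorem theorem7 (R : realType) :
  exists C : R, 0 < C /\
  forall (d : measure_display) (T : measurableType d) (P : probability T R)
    (d1 d2 : nat) (X : T -> 'M[R]_(d1, d2)) (Sigma : 'M[R]_d2)
    (alpha beta sigma L : R),
  (0 < d1)%N -> (0 < d2)%N ->
  1 <= alpha -> alpha^-1 + beta^-1 = 1 ->
  0 < sigma -> sigma <= L ->
  random_matrix X -> iid_rows P X -> mean_zero_rows P X ->
  (forall (i : 'I_d1) (u : 'cV[R]_d2) (k : nat), sphere u -> (2 <= k)%N ->
     ('E_P[fun w => (`|row_form X i u w ^+ 2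
                       - fine 'E_P[fun w' => row_form X i u w' ^+ 2]| ^+ k)%R]
      <= (k%:R `^ (k%:R / alpha) * sigma ^+ 2 * L ^+ (k - 2))%R%:E)%E) ->
  (forall i : 'I_d1, Sigma = second_moment P X i) ->
  let M_max := Num.sqrt (lambda_max Sigma) in
  let M_min := Num.sqrt (lambda_min Sigma) in
  let n1 : R := d1%:R in
  let n2 : R := d2%:R in
  (2 <= alpha -> forall t : R, 0 < t ->
     let err := C * Num.min
           (L * (n2 + t) `^ alpha^-1 * n1 `^ beta^-1)
           (sigma * (n2 + t) `^ 2^-1 * n1 `^ 2^-1 + L * (n2 + t)) in
     ((1 - expR (- t))%R%:E <=
      P [set w | (n1 * M_min ^+ 2 - err <= s_min (X w) ^+ 2
                 /\ s_min (X w) ^+ 2 <= s_max (X w) ^+ 2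
                 /\ s_max (X w) ^+ 2 <= n1 * M_max ^+ 2 + err)%R])%E)
  /\
  (alpha <= 2 -> forall t : R, 0 < t ->
     let err := C * sigma * (n2 + t) `^ 2^-1 * n1 `^ 2^-1
                + C * L * Num.min ((n2 + t) `^ alpha^-1 * n1 `^ beta^-1)
                                  (n2 + t) in
     ((1 - expR (- t))%R%:E <=
      P [set w | (n1 * M_min ^+ 2 - err <= s_min (X w) ^+ 2
                 /\ s_min (X w) ^+ 2 <= s_max (X w) ^+ 2
                 /\ s_max (X w) ^+ 2 <= n1 * M_max ^+ 2 + err)%R])%E).
Proof.
pose e : R := expR 1; have e0 : 0 < e := expR_gt0 1.
(* 18 comes from the tail bounds and 3 from the net; 2 is lost when a sum of two
   terms is compared with a minimum. *)
exists (108 * e); split; first by rewrite mulr_gt0.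
move=> d T P d1 d2 X Sigma alpha beta sigma L d1_gt0 d2_gt0 alpha1 ab sigma0 sigmaL
  mX [indep _] _ moments SigmaE M_max M_min n1 n2.
have L0 : 0 < L := lt_le_trans sigma0 sigmaL.
have n1_gt0 : 0 < n1 by rewrite ltr0n.
have a0 : 0 < alpha := lt_le_trans ltr01 alpha1.
have regimes (t err : R) : 0 < t ->
    let w := (n2 + t) / n1 in
    (w <= 1 -> 54 * e * (sigma * (n1 * w `^ 2^-1) + L * (n1 * w)) <= err) ->
    (1 <= w -> 54 * e * (L * (n1 * w `^ alpha^-1)) <= err) ->
    ((1 - expR (- t))%R%:E <=
      P [set w | (n1 * M_min ^+ 2 - err <= s_min (X w) ^+ 2
                 /\ s_min (X w) ^+ 2 <= s_max (X w) ^+ 2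
                 /\ s_max (X w) ^+ 2 <= n1 * M_max ^+ 2 + err)%R])%E.
  move=> t0 w hB hL.
  have s0 : 0 < n2 + t by rewrite ltr_wpDl.
  have sE : n2 + t = n1 * w by rewrite mulrC divfK ?gt_eqF.
  have w0 : 0 < w by rewrite divr_gt0.
  have key := singular_values_deviation d1_gt0 d2_gt0 mX moments SigmaE t0.
  have [w1|/ltW w1] := leP w 1.
    apply: key (bernstein_two_sided d1_gt0 alpha1 sigma0 sigmaL mX indep moments SigmaE s0).
      by rewrite !(mulr_ge0, addr_ge0) ?sqrtr_ge0 ?expR_ge0 ?(ltW sigma0) ?(ltW L0) ?(ltW t0).
    apply: le_trans (hB w1); rewrite -/n1 -/n2 sE.
    have -> : Num.sqrt (n1 * (n1 * w)) = n1 * w `^ 2^-1.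
      have nw : 0 <= n1 * w by rewrite mulr_ge0 ?(ltW w0) ?(ltW n1_gt0).
      rewrite -powR12_sqrt; last by rewrite mulr_ge0 ?(ltW n1_gt0).
      rewrite powRM ?(ltW n1_gt0)// mulrC -(powRM_interpolate _ n1_gt0 (ltW w0)).
      by congr (_ * _ `^ _); lra.
    by rewrite -/e; lra.
  have ns : d1%:R <= n2 + t by rewrite -/n1 sE ler_peMr// ltW.
  apply: key (large_deviation_two_sided d1_gt0 alpha1 sigma0 sigmaL mX indep moments SigmaE ns).
    by rewrite !mulr_ge0 ?powR_ge0 ?(ltW e0) ?(ltW L0) ?(ltW n1_gt0).
  by apply: le_trans (hL w1); rewrite -/n1 -/n2 -/w -/e; lra.
have powers w : 0 < w ->
  [/\ 0 <= w `^ 2^-1,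
      w <= 1 -> w <= w `^ alpha^-1,
      w <= 1 -> 2 <= alpha -> w `^ 2^-1 <= w `^ alpha^-1 &
      1 <= w -> w `^ alpha^-1 <= w].
  move=> w0; have ai : alpha^-1 <= 1 by rewrite invf_le1.
  split; rewrite ?powR_ge0// => w1.
  - by apply: ger1_powR; rewrite ?w0.
  - move=> a2; apply: ger_powR; first by rewrite w0.
    by rewrite lef_pV2// posrE.
  - exact: ler1_powR.
pose l := e * (n1 * L); pose r := e * (n1 * sigma).
have l0 : 0 <= l by rewrite !mulr_ge0 ?(ltW e0) ?(ltW n1_gt0) ?(ltW L0).
have r0 : 0 <= r by rewrite !mulr_ge0 ?(ltW e0) ?(ltW n1_gt0) ?(ltW sigma0).
have rl : r <= l by rewrite !ler_wpM2l ?(ltW e0) ?(ltW n1_gt0).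
have be : beta^-1 = 1 - alpha^-1 by rewrite -ab addrC addKr.
have half : (2^-1 : R) = 1 - 2^-1 by lra.
have scaled (t : R) : 0 < t -> let w := (n2 + t) / n1 in
    [/\ 0 < w, n2 + t = n1 * w,
      (n2 + t) `^ alpha^-1 * n1 `^ beta^-1 = n1 * w `^ alpha^-1 &
      (n2 + t) `^ 2^-1 * n1 `^ 2^-1 = n1 * w `^ 2^-1].
  move=> t0 w; have w0 : 0 < w by rewrite divr_gt0// ltr_wpDl.
  have sE : n2 + t = n1 * w by rewrite mulrC divfK ?gt_eqF.
  by rewrite sE be powRM_interpolate ?(ltW w0)// {2}half powRM_interpolate ?(ltW w0).
split => a2 t t0; lazy zeta; have [w0 sE E1 E2] := scaled t t0;
  set w := (n2 + t) / n1 in w0 sE E1 E2;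
  have [h0 W1 W2 W3] := powers w w0;
  apply: (regimes _ _ t0) => w1; rewrite -/w -!mulrA ?E1 ?E2 ?sE.
- have h1 := ler_wpM2r h0 rl.
  have h2 := ler_wpM2l l0 (W2 w1 a2); have h3 := ler_wpM2l l0 (W1 w1).
  have h4 := mulr_ge0 r0 h0; have h5 := mulr_ge0 l0 (ltW w0).
  by rewrite /Order.min; case: ifP => _; move: h1 h2 h3 h4 h5; rewrite /l /r => *; lra.
- have h1 := ler_wpM2l l0 (W3 w1).
  have h4 := mulr_ge0 r0 h0; have h5 := mulr_ge0 l0 (powR_ge0 w alpha^-1).
  by rewrite /Order.min; case: ifP => _; move: h1 h4 h5; rewrite /l /r => *; lra.
- have h3 := ler_wpM2l l0 (W1 w1).
  have h4 := mulr_ge0 r0 h0; have h5 := mulr_ge0 l0 (ltW w0).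
  by rewrite /Order.min; case: ifP => _; move: h3 h4 h5; rewrite /l /r => *; lra.
- have h1 := ler_wpM2l l0 (W3 w1).
  have h4 := mulr_ge0 r0 h0; have h5 := mulr_ge0 l0 (powR_ge0 w alpha^-1).
  by rewrite /Order.min; case: ifP => _; move: h1 h4 h5; rewrite /l /r => *; lra.
Qed.
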